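(* Let $\rho>0$ and let $K$ be a nonnegative integer. Let $N(t)$ be the total number of customers present at time $t$ in the symmetric join-the-shortest-queue system with two queues of capacity $K$ and global arrival rate $2\rho$, and let $\overline N(t)$, $\underline N(t)$ and $\underline{\underline N}(t)$ be the numbers of customers at time $t$ in, respectively, an $M/M/1/K$ queue with arrival rate $2\rho$ and service rate $2$, an $M/M/2/2K$ queue with arrival rate $2\rho$ and service rate $1$ per server, and an $M/M/1/2K$ queue with arrival rate $2\rho$ and service rate $2$. The four processes $N,\overline N,\underline N$ and $\underline{\underline N}$ can be coupled together (i.e. constructed on a common probability space) in such a way that the inequalities $$\underline{\underline N}(t)\le\underline N(t)\le N(t)\le K+\overline N(t)$$ are satisfied at all positive times $t$ if they hold at $t=0$.
   Context: $M/M/c/m$ denotes the queue with Poisson arrivals, i.i.d. exponential service times, $c$ servers, and at most $m$ customers in the system (including those in service); arrivals finding $m$ customers are lost. Symmetric finite-capacity JSQ model: two one-server queues, each of capacity $K$; service times are exponential with parameter $1$ at both queues; customers arrive according to a Poisson process with parameter $2\rho$ and join the shortest queue, or either queue with probability $1/2$ if both lengths are equal; when both queues have length $K$ arriving customers are lost. The queue-length process $(L_1(t),L_2(t))_{t\ge0}$ is the continuous-time Markov chain on $\{0,\dots,K\}^2$ with the following transition rates ($e_1,e_2$ the unit vectors). From $(k,k)$: to $(k,k)+e_1$ and to $(k,k)+e_2$ at rate $\rho$ each if $k<K$; to $(k,k)-e_1$ and to $(k,k)-e_2$ at rate $1$ each if $k>0$. From $(j,k)$ with $j<k$: to $(j+1,k)$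 at rate $2\rho$, to $(j-1,k)$ at rate $1$ if $j>0$, to $(j,k-1)$ at rate $1$. From $(k,j)$ with $j<k$: to $(k,j+1)$ at rate $2\rho$, to $(k,j-1)$ at rate $1$ if $j>0$, to $(k-1,j)$ at rate $1$. The total number of customers is $N(t)=L_1(t)+L_2(t)$. *)

(* Defs.v *)
From HB Require Import structures.
From mathcomp Require Import all_boot all_order all_algebra.
From mathcomp Require Import all_classical all_reals all_analysis.

Set Implicit Arguments.
Unset Strict Implicit.
Unset Printing Implicit Defensive.

Import Order.TTheory GRing.Theory Num.Theory.
Import numFieldNormedType.Exports.

Local Open Scope classical_set_scope.
Local Open Scope ring_scope.

(* Only times t >= 0 are meaningful. *)
Definition transition_function (R : realType) (S : finType)
    (p : R -> S -> S -> R) : Prop :=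
  [/\ forall t x y, 0 <= t -> 0 <= p t x y,
      forall t x, 0 <= t -> \sum_y p t x y = 1,
      forall x y, p 0 x y = (x == y)%:R
    & forall s t x y, 0 <= s -> 0 <= t ->
        p (s + t) x y = \sum_z p s x z * p t z y].

(* p_h(x, y) = r(x, y) h + o(h) as h decreases to 0, for x <> y; the diagonal  *)
(* of r is irrelevant, since the rows of p_h sum to 1.                         *)
Definition has_rates (R : realType) (S : finType)
    (p : R -> S -> S -> R) (r : S -> S -> R) : Prop :=
  forall x y, x != y -> h^-1 * p h x y @[h --> 0^'+] --> r x y.

(* X is a time-homogeneous Markov process with transition function p.  The     *)
(* Markov property is stated in product form, so that no conditioning on       *)
(* events of probability 0 occurs.                                             *)
Definition markov_with (R : realType) (d : measure_display)
    (Omega : measurableType d) (P : probability Omega R) (S : finType)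
    (X : R -> Omega -> S) (p : R -> S -> S -> R) : Prop :=
  forall (n : nat) (t : nat -> R) (s : nat -> S),
    0 <= t 0%N -> (forall i, (i <= n)%N -> t i <= t i.+1) ->
    P [set w | forall i, (i <= n.+1)%N -> X (t i) w = s i] =
    (P [set w | forall i, (i <= n)%N -> X (t i) w = s i] *
     (p (t n.+1 - t n) (s n) (s n.+1))%:E)%E.

Definition right_continuous_paths (R : realType) (Omega : Type) (S : finType)
    (X : R -> Omega -> S) : Prop :=
  forall w t, 0 <= t -> \forall u \near t^'+, X u w = X t w.

Definition is_ctmc (R : realType) (d : measure_display)
    (Omega : measurableType d) (P : probability Omega R) (S : finType)
    (r : S -> S -> R) (X : R -> Omega -> S) : Prop :=
  [/\ forall t x, 0 <= t -> measurable [set w | X t w = x],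
      right_continuous_paths X
    & exists p : R -> S -> S -> R,
        [/\ transition_function p, has_rates p r & markov_with P X p]].

(* Number of customers in an M/M/c/m queue with arrival rate lambda and        *)
(* service rate mu per server: minn i c servers are busy when i customers are  *)
(* present.  Arrivals at i = m are lost because m.+1 is not a state.           *)
Definition mmcm_rate (R : realType) (lambda mu : R) (c m : nat)
    (i j : 'I_m.+1) : R :=
  if j == i.+1 :> nat then lambda
  else if i == j.+1 :> nat then (minn i c)%:R * mu
  else 0.

(* Rate at which customers join the queue of length i when the other queue has *)
(* length j and customers arrive at rate 2 * rho.                              *)
Definition join_rate (R : realType) (rho : R) (i j : nat) : R :=
  if (i < j)%N then 2 * rho else if i == j then rho else 0.

(* Join-the-shortest-queue with two queues of capacity K; losses in (K, K) are *)
(* again accounted for by the state space.                                     *)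
Definition jsq_rate (R : realType) (rho : R) (K : nat)
    (x y : 'I_K.+1 * 'I_K.+1) : R :=
  if (y.1 == x.1.+1 :> nat) && (y.2 == x.2) then join_rate rho x.1 x.2
  else if (y.1 == x.1) && (y.2 == x.2.+1 :> nat) then join_rate rho x.2 x.1
  else if (x.1 == y.1.+1 :> nat) && (y.2 == x.2) then 1
  else if (y.1 == x.1) && (x.2 == y.2.+1 :> nat) then 1
  else 0.

(* Main.v *)
(* Four independent Poisson streams of marks drive all four queues: two streams *)
(* of arrivals of rate rho, one of (potential) departures of rate 1 from the   *)
(* longer queue and one of rate 1 from the shorter queue.  The single-server   *)
(* queues react to both kinds of departures, the M/M/2 queue ignores those     *)
(* from the shorter queue when it has at most one customer.  Each queue is a   *)
(* deterministic automaton fed with the same word of marks, and the            *)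
(* inequalities are preserved by each letter.                                  *)
(*                                                                             *)
(* The marked Poisson process is obtained from its restrictions to dyadic      *)
(* grids: at level m one records the word of marks in each of the first 4 ^ m  *)
(* cells of length 2 ^ - m, a countable set of values, and concatenation of    *)
(* neighbouring cells projects level m.+1 onto level m.  The word of marks met *)
(* up to time t is the eventual value, as m grows, of the word met in the      *)
(* cells that cover [0, t]; this makes paths right-continuous at every point,  *)
(* and the Markov property is the limit of exact identities on the grids.      *)

Require Import Defs.
From HB Require Import structures.
From mathcomp Require Import all_boot all_order all_algebra.
From mathcomp Require Import all_classical all_reals all_analysis.
From mathcomp Require Import ring lra zify.

Set Implicit Arguments.
Unset Strict Implicit.
Unset Printing Implicit Defensive.

Import Order.TTheory GRing.Theory Num.Theory.
Import numFieldNormedType.Exports.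

Local Open Scope classical_set_scope.
Local Open Scope ring_scope.

(** All queues react to the same marks, so the inequalities need only be checked for one mark
    ([ordered_counts_step]). An arrival raises every count that is below its capacity; the total of
    the two queues is blocked only at 2K, because the shortest queue is joined. A service wasted on
    an empty queue leaves the total unchanged, but then the total is at most K, which saves the
    upper bound. The mark for the shorter queue lowers the total only when both queues are nonempty,
    so only from a total of at least 2, and it lowers the M/M/2 count whenever that count is at
    least 2; hence the M/M/2 count stays below the total. The M/M/1/2K queue obeys every departure
    mark that the M/M/2/2K queue obeys.

    The probabilistic half is [driving_words_exist]: one space carries a growing random word such
    that every finite automaton reading it is a Markov chain ([driven_ctmc]), whose rate from x to y
    is the total rate of the marks sending x to y. The automata have the required rates by
    [jsq_step_rate], [mm1_rate] and [mm2_rate]. The semigroup property rests on [word_lawD], the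
    existence of the space on [prob_proj_var], and the passage from grids to real times on
    [prob_near] and [driven_trans_cvg]. *)

(** * Nonnegative sums over words and finite types *)

Section esum_extra.
Context {R : realType} {T : choiceType}.
Local Open Scope ereal_scope.

(** Bounding finite partial sums gives one inequality for every scalar; the converse is that
    inequality for [r^-1], the case [r = 0] being apart. *)
Lemma ge0_esumZl (D : set T) (r : R) (F : T -> \bar R) : (0 <= r)%R ->
  (forall x, 0 <= F x) ->
  \esum_(x in D) (r%:E * F x) = r%:E * \esum_(x in D) F x.
Proof.
have le_esumZ (s : R) (G : T -> \bar R) : (0 <= s)%R -> (forall x, 0 <= G x) ->
    \esum_(x in D) (s%:E * G x) <= s%:E * \esum_(x in D) G x.
  move=> s0 G0; apply: ge_ereal_sup => _ [X [finX XD]] <-.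
  rewrite -ge0_mule_fsumr//; apply: lee_pmul => //.
    by apply: fsume_ge0 => x _; exact: G0.
  by apply: esum_ge; exists X.
rewrite le_eqVlt => /predU1P[<-|r0] F0.
  by rewrite mul0e esum1// => x _; rewrite mul0e.
apply/eqP; rewrite eq_le le_esumZ ?(ltW r0)//=.
rewrite -[X in r%:E * X <= _](_ : \esum_(x in D)
    (r^-1%:E * (r%:E * F x)) = _); last first.
  by apply: eq_esum => x _; rewrite muleA -EFinM mulVf ?gt_eqF// mul1e.
rewrite -lee_pdivlMl//; apply: le_esumZ; first by rewrite invr_ge0 ltW.
by move=> x; rewrite mule_ge0// lee_fin ltW.
Qed.

Lemma esum_finType (S : finType) (F : S -> \bar R) : (forall x, 0 <= F x) ->
  \esum_(x in [set: S]) F x = \sum_x F x.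
Proof.
move=> F0; transitivity (\esum_(x in [set: S]) \sum_y
    if x \in [set y] then F x else 0).
  apply: eq_esum => x _; rewrite (bigD1 x)//= mem_set// big1 ?adde0// => y yx.
  by rewrite memNset// => /= /esym/eqP; exact/negP.
rewrite esum_sum; last by move=> x y _ _; case: ifP.
by apply: eq_bigr => y _; rewrite -esum_mkcond esum_set1.
Qed.

Lemma esum_ge1 (x : T) (F : T -> \bar R) : (forall x, 0 <= F x) ->
  F x <= \esum_(x in [set: T]) F x.
Proof.
by move=> F0; apply: esum_ge; exists [set x]; rewrite ?fsbig_set1//; split.
Qed.

Lemma esum_seq_cons (F : seq T -> \bar R) : (forall c, 0 <= F c) ->
  \esum_(c in [set: seq T]) F c =
  F [::] + \esum_(x in [set: T]) \esum_(c in [set: seq T]) F (x :: c).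
Proof.
move=> F0; rewrite (esumID [set [::]])// !setTI esum_set1//; congr (_ + _).
rewrite esum_esum//; apply: (reindex_esum _ _ (fun a => a.1 :: a.2)).
split => [a _|[x c] [y d] _ _ /= [-> ->]|[|x c]]//=.
by move=> _; exists (x, c).
Qed.

(** A pair of words is the same thing as a word with a cutting position [k]. *)
Lemma esum_cat (G : seq T -> seq T -> \bar R) : (forall u v, 0 <= G u v) ->
  \esum_(u in [set: seq T]) \esum_(v in [set: seq T]) G u v =
  \esum_(w in [set: seq T]) \sum_(k < (size w).+1) G (take k w) (drop k w).
Proof.
move=> G0; rewrite esum_esum//.
rewrite -[RHS](_ : \esum_(w in [set: seq T])
    \esum_(k in `I_(size w).+1) G (take k w) (drop k w) = _); last first.
  apply: eq_esum => w _; rewrite -(set_mem_set `I_(size w).+1) esum_fset//;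
    last by rewrite set_mem_set; exact: finite_II.
  rewrite set_mem_set (fsbig_ord +%E _ (fun k => G (take k w) (drop k w))).
  by [].
rewrite esum_esum//; apply/esym.
rewrite (reindex_esum ([set: seq T] `*` [set: seq T]) _
  (fun a => (a.1 ++ a.2, size a.1))); last first.
  split => [[u v] _|[u v] [u' v']|[w k] [_ /=]]/=.
  - by split => //=; rewrite size_cat ltnS leq_addr.
  - move=> _ _ [/eqP + uu']; rewrite eqseq_cat//.
    by move=> /andP[/eqP -> /eqP ->].
  - rewrite ltnS => kw; exists (take k w, drop k w) => //=.
    by rewrite cat_take_drop size_takel.
apply: eq_esum => -[u v] _ /=.
by rewrite take_size_cat// drop_size_cat.
Qed.

Lemma esum_partition (S : finType) (g : T -> S) (F : T -> \bar R) :
  (forall x, 0 <= F x) ->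
  \esum_(x in [set: T]) F x =
  \sum_y \esum_(x in [set: T]) (F x * (g x == y)%:R%:E).
Proof.
move=> F0; rewrite -esum_sum; last first.
  by move=> x y _ _; rewrite mule_ge0// lee_fin.
apply: eq_esum => x _; rewrite (bigD1 (g x))//= eqxx mule1 big1 ?adde0//.
by move=> y /negbTE; rewrite eq_sym => ->; rewrite mule0.
Qed.

End esum_extra.

(** * Poissonian words and the chains they drive *)

Section word_law.
Context {R : realType} {M : finType} (q : M -> R).
Hypothesis q_ge0 : forall u, 0 <= q u.

Definition total_rate : R := \sum_u q u.

(* The law of the word of marks met during a time interval of length t, when   *)
(* each mark u occurs at the points of a Poisson process of rate q u.          *)
Definition word_law (t : R) (w : seq M) : R :=
  expR (- (total_rate * t)) * t ^+ size w / (size w)`!%:R * \prod_(u <- w) q u.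

Lemma word_law_ge0 t w : 0 <= t -> 0 <= word_law t w.
Proof.
move=> t0; rewrite /word_law mulr_ge0 ?prodr_ge0// mulr_ge0 ?invr_ge0//.
by rewrite mulr_ge0 ?expR_ge0 ?exprn_ge0.
Qed.

Lemma word_law0 w : word_law 0 w = (w == [::])%:R.
Proof.
case: w => [|u w]; last by rewrite /word_law expr0n/= !(mulr0, mul0r).
by rewrite /word_law big_nil mulr0 oppr0 expR0 expr0 fact0 invr1 !mulr1.
Qed.

(** Binomial expansion of [(s + t) ^+ size w]: the term of index [k] is the case where exactly the
    first [k] marks fall in the first interval. *)
Lemma word_lawD s t w : word_law (s + t) w =
  \sum_(k < (size w).+1) word_law s (take k w) * word_law t (drop k w).
Proof.
rewrite /word_law; move: total_rate => L.
have bin_factV k : (k <= size w)%N -> 'C(size w, k)%:R / (size w)`!%:R =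
    k`!%:R^-1 * (size w - k)`!%:R^-1 :> R.
  move=> kw; rewrite -(bin_fact kw) !natrM; field.
  by rewrite !pnatr_eq0 -!lt0n !fact_gt0 bin_gt0 kw.
rewrite addrC exprDn mulr_sumr !mulr_suml.
apply: eq_bigr => -[k /= kw] _; rewrite ltnS in kw.
rewrite size_takel// size_drop.
rewrite -[in \prod_(u <- w) _](cat_take_drop k w) big_cat/=.
rewrite (mulrDr L) opprD expRD -mulr_natr.
transitivity (expR (- (L * t)) * expR (- (L * s)) * t ^+ (size w - k) *
    s ^+ k * ('C(size w, k)%:R / (size w)`!%:R) *
    (\prod_(u <- take k w) q u * \prod_(u <- drop k w) q u)).
  by ring.
by rewrite bin_factV//; ring.
Qed.

End word_law.

Section word_law_mass.
Context {R : realType} {M : finType} (q : M -> R).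
Hypothesis q_ge0 : forall u, 0 <= q u.
Hypothesis q_gt0 : 0 < total_rate q.

Lemma esum_prod_size n :
  \esum_(w in [set w : seq M | size w = n]) (\prod_(u <- w) q u)%:E =
  ((total_rate q) ^+ n)%:E.
Proof.
elim: n => [|n ih].
  rewrite (_ : [set _ | _] = [set [::]]); last first.
    by apply/seteqP; split => [[]|w ->].
  by rewrite esum_set1 big_nil.
rewrite (reindex_esum ([set: M] `*` [set w : seq M | size w = n]) _
  (fun a => a.1 :: a.2)); last first.
  split => [[u w] [_ /= ->]|[u w] [u' w'] _ _ /= [-> ->]|[|u w] //= [sw]]//.
  by exists (u, w).
under eq_esum do rewrite big_cons/= EFinM.
rewrite -(@esum_esum _ _ _ [set: M] (fun=> [set w : seq M | size w = n])
  (fun u w => (q u)%:E * (\prod_(v <- w) q v)%:E)%E); last first.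
  by move=> u w _ _; rewrite mule_ge0// lee_fin// prodr_ge0.
transitivity (\esum_(u in [set: M]) ((q u)%:E * ((total_rate q) ^+ n)%:E)%E).
  apply: eq_esum => u _; rewrite -ih ge0_esumZl// => w.
  by rewrite lee_fin prodr_ge0.
rewrite esum_finType; last first.
  by move=> u; rewrite mule_ge0// lee_fin// exprn_ge0// ltW.
rewrite exprS /total_rate mulr_suml -sumEFin.
by apply: eq_bigr => u _; rewrite EFinM.
Qed.

(** Grouped by length, the words follow the Poisson law of parameter [total_rate q * t], of mass 1;
    at [t = 0] all the mass sits on the empty word. *)
Lemma esum_word_law t : 0 <= t ->
  \esum_(w in [set: seq M]) (word_law q t w)%:E = 1%E.
Proof.
rewrite le_eqVlt => /predU1P[<-|t0].
  rewrite (esumID [set [::]]); last by move=> w _; rewrite word_law0 lee_fin.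
  rewrite !setTI esum_set1; last by rewrite word_law0 lee_fin.
  rewrite word_law0 eqxx esum1 ?adde0// => w /= /eqP.
  by rewrite word_law0 => /negbTE ->.
have r0 : 0 < total_rate q * t by rewrite mulr_gt0.
have w0 w : (0 <= (word_law q t w)%:E)%E by rewrite lee_fin word_law_ge0// ltW.
rewrite (_ : [set: seq M] = \bigcup_(n in [set: nat]) [set w | size w = n]).
  rewrite esum_bigcupT//; last by move=> m n _ _ [w [/= <- <-]].
  transitivity (\esum_(n in [set: nat]) (poisson_pmf (total_rate q * t) n)%:E);
    last by have := probability_setT (poisson_prob (total_rate q * t) 0%N);
      rewrite /= /poisson_prob r0.
  apply: eq_esum => n _.
  transitivity (\esum_(w in [set w : seq M | size w = n])
     ((expR (- (total_rate q * t)) * t ^+ n / n`!%:R)%:E *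
      (\prod_(u <- w) q u)%:E)%E).
    by apply: eq_esum => w /= <-; rewrite /word_law EFinM.
  have c0 : 0 <= expR (- (total_rate q * t)) * t ^+ n / n`!%:R.
    by rewrite mulr_ge0 ?invr_ge0// mulr_ge0 ?expR_ge0 ?exprn_ge0// ltW.
  rewrite ge0_esumZl//; last by move=> w; rewrite lee_fin prodr_ge0.
  rewrite esum_prod_size -EFinM /poisson_pmf r0 exprMn_comm; last exact: mulrC.
  by congr EFin; ring.
by apply/seteqP; split => // w _; exists (size w).
Qed.

Lemma word_law_nil t : word_law q t [::] = expR (- (total_rate q * t)).
Proof. by rewrite /word_law big_nil expr0 fact0 divr1 !mulr1. Qed.

Lemma word_law1 t u :
  word_law q t [:: u] = expR (- (total_rate q * t)) * t * q u.
Proof. by rewrite /word_law big_seq1 expr1 divr1. Qed.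

(** Independence of the words met in consecutive intervals, as an identity between means. *)
Lemma word_lawD_esum s t (F : seq M -> \bar R) : 0 <= s -> 0 <= t ->
  (forall w, (0 <= F w)%E) ->
  (\esum_(w in [set: seq M]) ((word_law q (s + t) w)%:E * F w) =
   \esum_(u in [set: seq M]) ((word_law q s u)%:E *
     \esum_(v in [set: seq M]) ((word_law q t v)%:E * F (u ++ v))))%E.
Proof.
move=> s0 t0 F0.
have w0 r w : 0 <= r -> (0 <= (word_law q r w)%:E)%E.
  by move=> r0; rewrite lee_fin word_law_ge0.
under [RHS]eq_esum => u _.
  rewrite -ge0_esumZl; [|exact: word_law_ge0|by move=> v; rewrite mule_ge0 ?w0].
  over.
rewrite esum_cat; last by move=> u v; rewrite !mule_ge0 ?w0.
apply: eq_esum => w _; rewrite word_lawD -sumEFin ge0_sume_distrl; last first.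
  by move=> k _; rewrite lee_fin mulr_ge0 ?word_law_ge0.
by apply: eq_bigr => k _; rewrite cat_take_drop EFinM muleA.
Qed.

End word_law_mass.

Section driven_chain.
Context {R : realType} {M : finType} (q : M -> R).
Hypothesis q_ge0 : forall u, 0 <= q u.
Hypothesis q_gt0 : 0 < total_rate q.
Context {S : finType} (f : S -> M -> S).

Definition driven_trans (t : R) (x y : S) : R :=
  fine (\esum_(w in [set: seq M])
    ((word_law q t w)%:E * (foldl f x w == y)%:R%:E)%E).

(** The diagonal is included: marks that fix [x] count in [driven_rate x x], so that each row sums
    to [total_rate q]. *)
Definition driven_rate (x y : S) : R := \sum_(u | f x u == y) q u.

Let summand_ge0 t x y w : 0 <= t ->
  (0 <= (word_law q t w)%:E * (foldl f x w == y)%:R%:E)%E.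
Proof. by move=> t0; rewrite mule_ge0// lee_fin// word_law_ge0. Qed.

(** The sum is at most the mass 1 of [word_law], so [fine] loses nothing. *)
Lemma driven_transE t x y : 0 <= t -> (driven_trans t x y)%:E =
  (\esum_(w in [set: seq M])
    ((word_law q t w)%:E * (foldl f x w == y)%:R%:E))%E.
Proof.
move=> t0; rewrite fineK// ge0_fin_numE; last first.
  by apply: esum_ge0 => w _; exact: summand_ge0.
apply: (@le_lt_trans _ _ 1%E); last exact: ltry.
rewrite -(esum_word_law q_ge0 q_gt0 t0); apply: le_esum => w _.
by case: eqP; rewrite ?mule1 ?mule0// lee_fin word_law_ge0.
Qed.

Lemma driven_trans_ge0 t x y : 0 <= t -> 0 <= driven_trans t x y.
Proof.
move=> t0; rewrite -lee_fin driven_transE//.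
by apply: esum_ge0 => w _; exact: summand_ge0.
Qed.

Lemma driven_trans_sum t x : 0 <= t -> \sum_y driven_trans t x y = 1.
Proof.
move=> t0; apply: EFin_inj; rewrite -sumEFin -(esum_word_law q_ge0 q_gt0 t0).
rewrite (esum_partition (foldl f x)) => [|w]; last first.
  by rewrite lee_fin word_law_ge0.
by apply: eq_bigr => y _; rewrite driven_transE.
Qed.

Lemma driven_trans0 x y : driven_trans 0 x y = (x == y)%:R.
Proof.
apply: EFin_inj; rewrite driven_transE//.
rewrite (esumID [set [::]]) => [|w _]; last exact: summand_ge0.
rewrite !setTI esum_set1; last exact: summand_ge0.
rewrite word_law0 eqxx mul1e esum1 ?adde0// => w /= /eqP.
by rewrite word_law0 => /negbTE ->; rewrite mul0e.
Qed.

(** The word is cut at time [s], and its first parts are sorted by the state they lead to. *)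
Lemma driven_transD s t x y : 0 <= s -> 0 <= t ->
  driven_trans (s + t) x y =
  \sum_z driven_trans s x z * driven_trans t z y.
Proof.
move=> s0 t0; apply: EFin_inj; rewrite driven_transE ?addr_ge0//.
rewrite word_lawD_esum//.
under eq_esum => u _.
  under eq_esum do rewrite foldl_cat.
  rewrite -driven_transE//; over.
rewrite (esum_partition (foldl f x)) => [|w]; last first.
  by rewrite mule_ge0// lee_fin ?word_law_ge0 ?driven_trans_ge0.
rewrite -sumEFin; apply: eq_bigr => z _.
rewrite EFinM driven_transE// muleC -ge0_esumZl ?driven_trans_ge0//; last first.
  by move=> w; exact: summand_ge0.
apply: eq_esum => w _; rewrite -muleA [RHS]muleCA; congr (_ * _)%E.
by have [->|] := eqVneq (foldl f x w) z; rewrite ?mule1 ?mule0.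
Qed.

Lemma driven_transP : transition_function driven_trans.
Proof.
split; [by move=> *; exact: driven_trans_ge0|by move=> *; exact: driven_trans_sum
  |exact: driven_trans0|by move=> *; exact: driven_transD].
Qed.

(** Only the words with at most one mark are kept; the others weigh O(t^2). *)
Lemma driven_trans_ge t x y : 0 <= t ->
  expR (- (total_rate q * t)) * ((x == y)%:R + t * driven_rate x y) <=
  driven_trans t x y.
Proof.
move=> t0; rewrite -lee_fin driven_transE// esum_seq_cons => [|w]; last first.
  exact: summand_ge0.
rewrite mulrDr EFinD word_law_nil -EFinM leeD2l//.
apply: (@le_trans _ _ (\esum_(u in [set: M])
    ((word_law q t [:: u])%:E * (f x u == y)%:R%:E))%E); last first.
  apply: le_esum => u _.
  by apply: le_trans (esum_ge1 [::] _) => // w; exact: summand_ge0.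
rewrite esum_finType => [|u]; last exact: (summand_ge0 x y [:: u]).
rewrite /driven_rate !mulr_sumr big_mkcond -sumEFin/=; apply: lee_sum => u _.
rewrite word_law1 -EFinM lee_fin mulrA.
by case: eqP => _; rewrite ?mulr1 ?mulr0.
Qed.

Lemma driven_rate_sum x : \sum_y driven_rate x y = total_rate q.
Proof.
rewrite /total_rate (partition_big (f x) predT)//=.
Qed.

Lemma driven_trans_stay_ge t x : 0 <= t ->
  expR (- (total_rate q * t)) <= driven_trans t x x.
Proof.
move=> t0; apply: le_trans (driven_trans_ge x x t0).
by rewrite eqxx ler_peMr ?expR_ge0// lerDl mulr_ge0// sumr_ge0.
Qed.

(* Subtracting from 1 the lower bounds for the other targets gives an upper    *)
(* bound which agrees with the lower one up to O(h ^ 2).                       *)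
Lemma driven_trans_rate_le h x y : 0 < h -> x != y ->
  `|h^-1 * driven_trans h x y - driven_rate x y| <= total_rate q ^+ 2 * h.
Proof.
move=> h0 xy; have h0' := ltW h0.
have lb := driven_trans_ge x y h0'.
have := driven_trans_sum x h0'; rewrite (bigD1 y)//= => sum1.
have : \sum_(z | z != y) expR (- (total_rate q * h)) *
    ((x == z)%:R + h * driven_rate x z) <= \sum_(z | z != y) driven_trans h x z.
  by apply: ler_sum => z _; exact: driven_trans_ge.
rewrite -mulr_sumr big_split/= -mulr_sumr.
have -> : \sum_(z | z != y) (x == z)%:R = 1 :> R.
  rewrite (bigD1 x)//= eqxx big1 ?addr0// => z /andP[_ /negbTE].
  by rewrite eq_sym => ->.
have := driven_rate_sum x; rewrite (bigD1 y)//= => rsum.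
have r0 z : 0 <= driven_rate x z by apply: sumr_ge0.
have : 0 <= \sum_(z | z != y) driven_rate x z by apply: sumr_ge0.
move: rsum lb (r0 y); rewrite (negbTE xy) add0r.
set a := \sum_(z | z != y) driven_rate x z.
set b := \sum_(z | z != y) driven_trans h x z in sum1 *.
set r := driven_rate x y; set L := total_rate q.
set p := driven_trans h x y in sum1 *.
move=> aL lb ry a0 ub.
have e1 := expR_ge1Dx (- (L * h)).
have e2 : expR (- (L * h)) <= 1 by rewrite expR_le1 oppr_le0 mulr_ge0 ?ltW.
set e := expR _ in lb ub e1 e2.
have -> : h^-1 * p - r = h^-1 * (p - h * r) by rewrite mulrBr mulKf ?gt_eqF.
rewrite normrM gtr0_norm ?invr_gt0// ler_pdivrMl// mulrCA -expr2.
have hr0 : 0 <= h * r by rewrite mulr_ge0.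
have ha0 : 0 <= h * a by rewrite mulr_ge0.
have Lh : L * h = h * r + h * a by rewrite -aL mulrC mulrDr.
rewrite -exprMn; move: e1 ub lb hr0 ha0; rewrite Lh.
move: (h * r) (h * a) => A B e1 ub lb A0 B0.
rewrite ler_norml; apply/andP; split.
  have : (1 - e) * A <= (A + B) * A by apply: ler_wpM2r => //; lra.
  have : 0 <= A * B + B * B by rewrite addr_ge0 ?mulr_ge0.
  by lra.
have : (1 - (A + B)) * (1 + B) <= e * (1 + B) by apply: ler_wpM2r; lra.
have : 0 <= A * A + A * B by rewrite addr_ge0 ?mulr_ge0.
by lra.
Qed.

Lemma driven_has_rates : has_rates driven_trans driven_rate.
Proof.
move=> x y xy; apply/cvgrPdist_le => e e0.
near=> h; rewrite distrC (le_trans (driven_trans_rate_le _ _))//.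
rewrite -ler_pdivlMl ?exprn_gt0//.
near: h; apply: nbhs_right_le; rewrite mulr_gt0// invr_gt0 exprn_gt0//.
Unshelve. all: by end_near. Qed.

(** The first [h] units of time are split off: the chain is then still in [x] with probability at
    least [1 - total_rate q * h], and the other states share the complement. *)
Lemma driven_trans_lip s h x y : 0 <= s -> 0 <= h ->
  `|driven_trans (s + h) x y - driven_trans s x y| <= total_rate q * h.
Proof.
move=> s0 h0; rewrite (addrC s) driven_transD// (bigD1 x)//=.
have p1 z : 0 <= driven_trans s z y <= 1.
  rewrite driven_trans_ge0//= -(driven_trans_sum z s0) (bigD1 y)//= lerDl.
  by rewrite sumr_ge0// => *; exact: driven_trans_ge0.
have := driven_trans_sum x h0; rewrite (bigD1 x)//= => sum1.
set D := driven_trans h x x in sum1 *.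
have D1 : 1 - total_rate q * h <= D.
  exact: le_trans (expR_ge1Dx _) (driven_trans_stay_ge _ h0).
set E := \sum_(i | i != x) _ in sum1; set F := \sum_(i | i != x) _.
have F0 : 0 <= F.
  apply: sumr_ge0 => z _; rewrite mulr_ge0 ?driven_trans_ge0//.
have FE : F <= E.
  apply: ler_sum => z _; rewrite ler_piMr ?driven_trans_ge0//.
  by case/andP: (p1 z).
have /andP[a0 a1] := p1 x.
have E0 : 0 <= E by exact: le_trans FE.
rewrite ler_norml; apply/andP; split; nra.
Qed.

End driven_chain.

(** * Inverse limits of countable laws *)

Section sampling.
Context {R : realType} {C : countType}.
Implicit Types a : C -> R.

(** Distribution function along the enumeration [pickle]; codes that name no element add 0. *)
Definition cumul a (n : nat) : R :=
  \sum_(k < n) oapp a 0 (pickle_inv k).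

Definition slot a (c : C) : set R :=
  `[cumul a (pickle c), cumul a (pickle c) + a c[.

Lemma cumulS a c : cumul a (pickle c).+1 = cumul a (pickle c) + a c.
Proof. by rewrite /cumul big_ord_recr/= pickleK_inv. Qed.

Lemma cumul_ge0 a n : (forall c, 0 <= a c) -> 0 <= cumul a n.
Proof. by move=> a0; apply: sumr_ge0 => k _; case: pickle_inv. Qed.

Lemma le_cumul a m n : (forall c, 0 <= a c) -> (m <= n)%N ->
  cumul a m <= cumul a n.
Proof.
move=> a0 /subnKC <-; rewrite /cumul big_split_ord/= lerDl.
by apply: sumr_ge0 => k _; case: pickle_inv.
Qed.

Lemma esum_cumul a : (forall c, 0 <= a c) ->
  (\sum_(k <oo) (oapp a 0 (pickle_inv k))%:E =
   \esum_(c in [set: C]) (a c)%:E)%E.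
Proof.
move=> a0; rewrite nneseries_esumT; last first.
  by move=> k; case: pickle_inv => //= c; rewrite lee_fin.
rewrite (esumID [set pickle c | c in [set: C]]); last first.
  by move=> k _; case: pickle_inv => //= c; rewrite lee_fin.
rewrite !setTI [X in (_ + X)%E]esum1 ?adde0 => [|k]; last first.
  have := @pickle_invK C k; case: pickle_inv => //= c <- [].
  by exists c.
rewrite esum_image; last by move=> c d _ _; exact: (pcan_inj pickleK_inv).
by apply: eq_esum => c _; rewrite pickleK_inv.
Qed.

Lemma cumul_le a r n : (forall c, 0 <= a c) ->
  \esum_(c in [set: C]) (a c)%:E = r%:E -> cumul a n <= r.
Proof.
move=> a0 ar; rewrite -lee_fin -ar -esum_cumul// /cumul -sumEFin.
rewrite -(big_mkord xpredT (fun k => (oapp a 0 (pickle_inv k))%:E)).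
by apply: nneseries_lim_ge => k _; case: pickle_inv => //= c; rewrite lee_fin.
Qed.

Lemma slot_sub a r c : (forall c, 0 <= a c) ->
  \esum_(c in [set: C]) (a c)%:E = r%:E -> slot a c `<=` `[0, r[.
Proof.
move=> a0 ar x; rewrite /slot/= !in_itv/= => /andP[cx].
rewrite -cumulS => xc; rewrite (le_trans _ cx) ?cumul_ge0//=.
exact: lt_le_trans xc (cumul_le _ _ _).
Qed.

Lemma slot_ex a r x : (forall c, 0 <= a c) ->
  \esum_(c in [set: C]) (a c)%:E = r%:E -> 0 <= x < r ->
  exists2 c, 0 < a c & slot a c x.
Proof.
move=> a0 ar /andP[x0 xr].
have exn : exists n, x < cumul a n.
  apply: contrapT => /forallNP cx; move: xr; apply/negP; rewrite -leNgt.
  rewrite -lee_fin -ar -esum_cumul//; apply: lime_le.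
    apply: is_cvg_nneseries => k _ _.
    by case: pickle_inv => //= c; rewrite lee_fin.
  apply: nearW => n; rewrite big_mkord sumEFin lee_fin leNgt.
  by apply/negP; exact: cx.
(* The least [n] with [x < cumul a n] is positive because [cumul a 0 = 0 <= x]; its predecessor is
   the code of the element sought. *)
case: (ex_minnP exn) => {exn} -[|n] xn nmin.
  by move: xn; rewrite /cumul big_ord0 ltNge x0.
have nx : cumul a n <= x.
  by rewrite leNgt; apply/negP => /nmin; rewrite ltnn.
have := @pickle_invK C n; move: xn; rewrite /cumul big_ord_recr/=.
case: pickle_inv => [c/= + nc|]; last first.
  by rewrite addr0 => /(le_lt_trans nx); rewrite ltxx.
rewrite -[\sum_(k < n) _]/(cumul a n) => xn; exists c.
  by rewrite -(ltrD2l (cumul a n)) addr0 (le_lt_trans nx).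
by rewrite /slot nc/= in_itv/= nx.
Qed.

Lemma slot_inj a x c d : (forall c, 0 <= a c) ->
  slot a c x -> slot a d x -> c = d.
Proof.
move=> a0; wlog cd : c d / (pickle c <= pickle d)%N.
  move=> H; have [/H//|/ltnW/H hh cx dx] := leqP (pickle c) (pickle d).
  by apply/esym/hh.
rewrite /slot/= !in_itv/= => /andP[_ xc] /andP[dx _].
apply: (pcan_inj pickleK_inv); apply/eqP; move: cd.
rewrite leq_eqVlt => /predU1P[/eqP//|/(le_cumul a0)].
by rewrite cumulS => /le_trans/(_ dx)/(lt_le_trans xc); rewrite ltxx.
Qed.

End sampling.

(* The laws nu m are realized on [0, 1[ by nested partitions into half-open    *)
(* intervals of lengths nu m c, so that the compatibility with the projections *)
(* g m holds at every point and not only almost surely.                        *)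
Section inverse_limit.
Context {R : realType} {C : countType} (nu : nat -> C -> R) (g : nat -> C -> C).
Hypothesis nu_ge0 : forall m c, 0 <= nu m c.
Hypothesis nu_sum1 : \esum_(c in [set: C]) (nu 0%N c)%:E = 1%E.

Let fiber m c d : R := if g m d == c then nu m.+1 d else 0.

Hypothesis nu_proj : forall m c,
  \esum_(d in [set: C]) (fiber m c d)%:E = (nu m c)%:E.

Let fiber_ge0 m c d : 0 <= fiber m c d.
Proof. by rewrite /fiber; case: ifP. Qed.

(** The cell of the parent [g m c] is cut into the slots of the masses of its fibre. *)
Fixpoint cell_base (m : nat) (c : C) : R :=
  if m is m'.+1 then
    cell_base m' (g m' c) + cumul (fiber m' (g m' c)) (pickle c)
  else cumul (nu 0%N) (pickle c).

Definition cell (m : nat) (c : C) : set R :=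
  `[cell_base m c, cell_base m c + nu m c[.

Lemma cellS m c x : cell m.+1 c x <->
  slot (fiber m (g m c)) c (x - cell_base m (g m c)).
Proof.
by rewrite /cell /slot/= !in_itv/= /fiber eqxx lerBrDl ltrBlDl addrA.
Qed.

Lemma cell_proj m c : cell m.+1 c `<=` cell m (g m c).
Proof.
move=> x /cellS /(slot_sub (fiber_ge0 m (g m c)) (nu_proj m _)).
by rewrite /cell/= !in_itv/= subr_ge0 ltrBlDl.
Qed.

Lemma cell_sub m c : cell m c `<=` `[0, 1[.
Proof.
elim: m c => [|m ih] c x; last by move=> /cell_proj; exact: ih.
exact: (@slot_sub _ _ (nu 0%N) 1 c (nu_ge0 0%N) nu_sum1).
Qed.

Lemma cell_ex m x : 0 <= x < 1 -> exists c, cell m c x.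
Proof.
move=> x01; elim: m => [|m [c]].
  have [c _ cx] := slot_ex (nu_ge0 0%N) nu_sum1 x01; by exists c.
rewrite /cell/= in_itv/= -subr_ge0 -ltrBlDl.
move=> /(slot_ex (fiber_ge0 m c) (nu_proj m c))[d].
(* The positive mass provided by [slot_ex] forces [g m d = c]. *)
rewrite {1}/fiber; case: eqP => [<- _ dx|]; last by rewrite ltxx.
by exists d; apply/cellS.
Qed.

Lemma cell_inj m x c d : cell m c x -> cell m d x -> c = d.
Proof.
elim: m c d => [|m ih] c d; first exact: slot_inj.
move=> cx dx; have gcd := ih _ _ (cell_proj cx) (cell_proj dx).
move/cellS : cx; move/cellS : dx; rewrite gcd => dx cx.
exact: slot_inj cx dx.
Qed.

(** Points outside [[0, 1[], which have uniform mass 0, are sent to 0 so that [proj_var] is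
    compatible with the projections on all of [R]. *)
Definition clamp01 (x : R) : R := if 0 <= x < 1 then x else 0.

Lemma clamp01P x : 0 <= clamp01 x < 1.
Proof. by rewrite /clamp01; case: ifPn => //; rewrite lexx ltr01. Qed.

Definition proj_var (m : nat) (x : R) : C :=
  sval (cid (cell_ex m (clamp01P x))).

Lemma proj_varP m x : cell m (proj_var m x) (clamp01 x).
Proof. by rewrite /proj_var; case: cid. Qed.

(** A cell that contains a point has positive length. Hence what holds wherever the law is nonzero
    holds at every sample point. *)
Lemma proj_var_neq0 m x : nu m (proj_var m x) != 0.
Proof.
have := proj_varP m x; rewrite /cell/= in_itv/= => /andP[/le_lt_trans H /H].
by rewrite ltrDl; exact: lt0r_neq0.
Qed.

Lemma proj_varS m x : g m (proj_var m.+1 x) = proj_var m x.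
Proof. exact: cell_inj (cell_proj (proj_varP m.+1 x)) (proj_varP m x). Qed.

Lemma preimage_proj_var m c :
  [set x | proj_var m x = c] = clamp01 @^-1` cell m c.
Proof.
apply/seteqP; split => x /=; first by move=> <-; exact: proj_varP.
exact/cell_inj/proj_varP.
Qed.

Lemma measurable_clamp01 (A : set R) : measurable A ->
  measurable (clamp01 @^-1` A).
Proof.
move=> mA; rewrite (_ : _ @^-1` _ = (A `&` `[0, 1[) `|`
    (if 0 \in A then ~` `[0, 1[ else set0)).
  apply: measurableU; first exact: measurableI.
  by case: ifP => _ //; apply: measurableC.
apply/seteqP; split => x /=; rewrite /clamp01.
  case: ifPn => [x01 Ax|x01 A0]; first by left; rewrite in_itv.
  by right; rewrite mem_set//= in_itv/=; exact/negP.
move=> [[Ax]|]; first by rewrite in_itv/= => ->.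
by case: ifPn => // /set_mem A0 /=; rewrite in_itv/= => /negP/negbTE ->.
Qed.

Local Notation P := (uniform_prob (@ltr01 R)).

Lemma uniform_prob_itvco (a b : R) : 0 <= a -> a <= b -> b <= 1 ->
  P `[a, b[ = (b - a)%:E.
Proof.
move=> a0 ab b1; rewrite /uniform_prob.
rewrite (eq_integral (fun=> 1%E)) => [|x]; last first.
  rewrite inE/= in_itv/= /uniform_pdf => /andP[ax xb].
  by rewrite (le_trans a0 ax) (ltW (lt_le_trans xb b1)) subr0 invr1.
rewrite integral_cst//= mul1e lebesgue_measure_itv/= lte_fin.
by move: ab; rewrite le_eqVlt => /predU1P[->|->]; rewrite ?ltxx ?subrr// EFinB.
Qed.

Lemma uniform_prob_clamp01 (A : set R) : measurable A -> A `<=` `[0, 1[ ->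
  P (clamp01 @^-1` A) = P A.
Proof.
move=> mA A01.
have P0 : P (~` `[0, 1[) = 0%E.
  rewrite probability_setC// [X in (_ - X)%E](_ : _ = 1%E) ?subee//.
  by have := @uniform_prob_itvco 0 1 (lexx 0) ler01 (lexx 1); rewrite subr0.
apply/eqP; rewrite eq_le; apply/andP; split.
  apply: (@le_trans _ _ (P (A `|` ~` `[0, 1[))).
    apply: le_measure; rewrite ?inE; [exact: measurable_clamp01| |].
      by apply: measurableU => //; exact: measurableC.
    move=> x /=; rewrite /clamp01; case: ifPn => [x01 Ax|x01 _]; [by left|right].
    by rewrite /= in_itv/=; exact/negP.
  apply: (le_trans (measureU2 _ _ _)) => //; first exact: measurableC.
  by rewrite [X in (_ + X)%E]P0 adde0.
apply: le_measure; rewrite ?inE//; first exact: measurable_clamp01.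
move=> x Ax /=; rewrite /clamp01.
by have := A01 _ Ax; rewrite /= in_itv/= => ->.
Qed.

Lemma measurable_cell m c : measurable (cell m c).
Proof. exact: measurable_itv. Qed.

Lemma measurable_proj_var m c : measurable [set x | proj_var m x = c].
Proof.
by rewrite preimage_proj_var; apply: measurable_clamp01; exact: measurable_cell.
Qed.

Lemma prob_proj_var m c : P [set x | proj_var m x = c] = (nu m c)%:E.
Proof.
rewrite preimage_proj_var uniform_prob_clamp01;
  [|exact: measurable_cell|exact: cell_sub].
have [nu0|nu0] := eqVneq (nu m c) 0.
  by rewrite /cell nu0 addr0 set_itvco0 measure0.
have nu_gt0 : 0 < nu m c by rewrite lt_neqAle eq_sym nu0 nu_ge0.
have : cell m c (cell_base m c).
  by rewrite /cell/= in_itv/= lexx ltrDl.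
move=> /cell_sub; rewrite /= in_itv/= => /andP[b0 b1].
rewrite uniform_prob_itvco// ?lerDl ?(ltW nu_gt0)//.
  by rewrite addrAC subrr add0r.
(* A cell reaching beyond 1 would contain 1, against [cell_sub]. *)
rewrite leNgt; apply/negP => lt1.
suff : cell m c 1 by move=> /cell_sub; rewrite /= in_itv/= ltxx andbF.
by rewrite /cell/= in_itv/= ltW.
Qed.

End inverse_limit.

(** * Laws of countably valued variables *)

Section discrete_variable.
Context {R : realType} {d} {Omega : measurableType d} (P : probability Omega R).
Context {C : countType} (X : Omega -> C) (nu : C -> R).
Hypothesis mX : forall c, measurable [set w | X w = c].
Hypothesis PX : forall c, P [set w | X w = c] = (nu c)%:E.

Let piece (A : set C) (k : nat) : set Omega :=
  if pickle_inv k is Some c then [set w | A c /\ X w = c] else set0.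

Let measurable_piece A k : measurable (piece A k).
Proof.
rewrite /piece; case: pickle_inv => // c.
have [Ac|nAc] := pselect (A c).
  rewrite (_ : [set _ | _] = [set w | X w = c])//.
  by apply/seteqP; split => w // [].
by rewrite (_ : [set _ | _] = set0)//; apply/seteqP; split => w // [].
Qed.

Let bigcup_piece A : [set w | A (X w)] = \bigcup_k piece A k.
Proof.
apply/seteqP; split => [w /= Aw|w [k _]].
  by exists (pickle (X w)) => //; rewrite /piece pickleK_inv.
by rewrite /piece; case: pickle_inv => // c [/= Ac ->].
Qed.

Lemma measurable_discrete (A : set C) : measurable [set w | A (X w)].
Proof. by rewrite bigcup_piece; apply: bigcupT_measurable => k. Qed.

Lemma prob_discrete (A : set C) :
  P [set w | A (X w)] = \esum_(c in A) (nu c)%:E.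
Proof.
have nu0 c : 0 <= nu c by rewrite -lee_fin -PX.
rewrite bigcup_piece measure_semi_bigcup//; last 2 first.
  move=> i j _ _ [w []]; rewrite /piece.
  have := @pickle_invK C i; have := @pickle_invK C j.
  by case: pickle_inv => // c /= <-; case: pickle_inv => // c' /= <- [_ <-] [_ <-].
  exact: bigcupT_measurable.
rewrite esum_mkcond.
rewrite (@eq_esum _ _ _ _ (fun c => (if c \in A then nu c else 0)%:E)); last first.
  by move=> c _; case: ifP.
rewrite -esum_cumul => [|c]; last by case: ifP.
apply: eq_eseriesr => k _; rewrite /piece; case: pickle_inv => [c|]/=; last first.
  by rewrite measure0.
case: ifPn => [/set_mem Ac|]; last first.
  rewrite notin_setE => nAc; rewrite (_ : [set _ | _] = set0) ?measure0//.
  by apply/seteqP; split => w // [].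
by rewrite -PX; congr (P _); apply/seteqP; split => w // [].
Qed.

End discrete_variable.

(** * Words on dyadic grids *)

Section cells_law.
Context {R : realType} {T : countType}.
Implicit Types (kappa : seq T -> R) (F : seq (seq T) -> \bar R).

Fixpoint cells_law kappa (n : nat) (c : seq (seq T)) : R :=
  match n, c with
  | 0%N, [::] => 1
  | n'.+1, w :: c' => kappa w * cells_law kappa n' c'
  | _, _ => 0
  end.

Definition cells_mean kappa n F : \bar R :=
  \esum_(c in [set: seq (seq T)]) ((cells_law kappa n c)%:E * F c)%E.

Lemma cells_law_ge0 kappa n c : (forall w, 0 <= kappa w) ->
  0 <= cells_law kappa n c.
Proof. by move=> k0; elim: n c => [|n ih] [|w c]//=; rewrite mulr_ge0. Qed.

Lemma cells_law_size kappa n c : cells_law kappa n c != 0 -> size c = n.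
Proof.
elim: n c => [|n ih] [|w c]//=; rewrite ?eqxx//.
by move=> kc; congr S; apply: ih; apply: contraNN kc => /eqP ->; rewrite mulr0.
Qed.

Section mean.
Context kappa (kappa_ge0 : forall w, 0 <= kappa w).

Lemma cells_mean_ge0 n F : (forall c, 0 <= F c)%E ->
  (0 <= cells_mean kappa n F)%E.
Proof.
by move=> F0; apply: esum_ge0 => c _; rewrite mule_ge0// lee_fin cells_law_ge0.
Qed.

Lemma eq_cells_mean n F G : (forall c, size c = n -> F c = G c) ->
  cells_mean kappa n F = cells_mean kappa n G.
Proof.
move=> FG; apply: eq_esum => c _.
have [->|/cells_law_size/FG ->//] := eqVneq (cells_law kappa n c) 0.
by rewrite !mul0e.
Qed.

Lemma cells_mean0 F : (forall c, 0 <= F c)%E -> cells_mean kappa 0 F = F [::].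
Proof.
move=> F0; rewrite /cells_mean esum_seq_cons => [|c]; last first.
  by rewrite mule_ge0// lee_fin cells_law_ge0.
rewrite mul1e esum1 ?adde0// => w _.
by rewrite esum1// => c _; rewrite mul0e.
Qed.

Lemma cells_meanS n F : (forall c, 0 <= F c)%E ->
  cells_mean kappa n.+1 F =
  \esum_(w in [set: seq T])
    ((kappa w)%:E * cells_mean kappa n (fun c => F (w :: c)))%E.
Proof.
move=> F0; rewrite /cells_mean esum_seq_cons => [|c]; last first.
  by rewrite mule_ge0// lee_fin cells_law_ge0.
rewrite mul0e add0e; apply: eq_esum => w _; rewrite -ge0_esumZl//; last first.
  by move=> c; rewrite mule_ge0// lee_fin cells_law_ge0.
by apply: eq_esum => c _; rewrite /= EFinM muleA.
Qed.

Lemma cells_meanZl n F r : 0 <= r -> (forall c, 0 <= F c)%E ->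
  (cells_mean kappa n (fun c => r%:E * F c) = r%:E * cells_mean kappa n F)%E.
Proof.
move=> r0 F0; rewrite -ge0_esumZl// => [|c].
  by apply: eq_esum => c _; rewrite muleCA.
by rewrite mule_ge0// lee_fin cells_law_ge0.
Qed.

Lemma cells_meanD m n F : (forall c, 0 <= F c)%E ->
  cells_mean kappa (m + n) F =
  cells_mean kappa m (fun u => cells_mean kappa n (fun v => F (u ++ v))).
Proof.
elim: m F => [|m ih] F F0.
  by rewrite cells_mean0// => u; exact: cells_mean_ge0.
rewrite addSn !cells_meanS//; last by move=> u; exact: cells_mean_ge0.
by apply: eq_esum => w _; rewrite ih.
Qed.

Lemma cells_mean_law n c :
  cells_mean kappa n (fun d => (d == c)%:R%:E) = (cells_law kappa n c)%:E.
Proof.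
rewrite /cells_mean (esumID [set c]) => [|d _]; last first.
  by rewrite mule_ge0// lee_fin cells_law_ge0.
rewrite !setTI esum_set1 ?eqxx ?mule1 ?lee_fin ?cells_law_ge0//.
by rewrite esum1 ?adde0// => d /= /eqP/negbTE ->; rewrite mule0.
Qed.

Hypothesis kappa_sum1 : \esum_(w in [set: seq T]) (kappa w)%:E = 1%E.

Lemma cells_mean_cst n r : 0 <= r -> cells_mean kappa n (fun=> r%:E) = r%:E.
Proof.
move=> r0; elim: n => [|n ih]; first by rewrite cells_mean0.
rewrite cells_meanS// ih -[RHS]mule1 -kappa_sum1 -ge0_esumZl//.
by apply: eq_esum => w _; rewrite muleC.
Qed.

(** The cells after the first [m] are summed out, each having mass 1. *)
Lemma cells_mean_take m n (F : seq (seq T) -> R) : (forall c, 0 <= F c) ->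
  (m <= n)%N ->
  cells_mean kappa n (fun c => (F (take m c))%:E) =
  cells_mean kappa m (fun c => (F c)%:E).
Proof.
move=> F0 /subnKC <-; rewrite cells_meanD => [|c]; last by rewrite lee_fin.
apply: eq_cells_mean => u um; rewrite -[RHS](cells_mean_cst (n - m))//.
by congr cells_mean; apply/funext => v; rewrite take_size_cat.
Qed.

End mean.

(** An unpaired last cell is dropped, whence the parity hypothesis in [flatten_pair_cells]. *)
Fixpoint pair_cells (c : seq (seq T)) : seq (seq T) :=
  if c is a :: b :: c' then (a ++ b) :: pair_cells c' else [::].

Lemma take_pair_cells k c : take k (pair_cells c) = pair_cells (take k.*2 c).
Proof.
elim: k c => [|k ih] c; first by rewrite !take0.
by case: c => [|a [|b c]]//=; rewrite ih.
Qed.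

Lemma flatten_pair_cells c : ~~ odd (size c) ->
  flatten (pair_cells c) = flatten c.
Proof.
move: {-1}(size c) (erefl (size c)) => n; elim/ltn_ind: n c => n ih.
case=> [|a [|b c]]//= cn; first by rewrite -cn.
by rewrite -{1}cn/= negbK => c_even; rewrite -catA (ih (size c))// -cn.
Qed.

End cells_law.

Section cells_word_law.
Context {R : realType} {M : finType} (q : M -> R).
Hypothesis q_ge0 : forall u, 0 <= q u.
Hypothesis q_gt0 : 0 < total_rate q.
Context (delta : R) (delta_ge0 : 0 <= delta).

Let kappa_ge0 t w : 0 <= t -> 0 <= word_law q t w.
Proof. exact: word_law_ge0. Qed.

Lemma cells_mean_flatten n (F : seq M -> \bar R) : (forall w, 0 <= F w)%E ->
  cells_mean (word_law q delta) n (fun c => F (flatten c)) =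
  (\esum_(w in [set: seq M]) ((word_law q (n%:R * delta) w)%:E * F w))%E.
Proof.
elim: n F => [|n ih] F F0.
  rewrite cells_mean0//= ?mul0r; last by move=> w; exact: kappa_ge0.
  rewrite (esumID [set [::]]) => [|w _]; last first.
    by rewrite mule_ge0// lee_fin word_law0.
  rewrite !setTI esum_set1; last by rewrite mule_ge0// lee_fin word_law0.
  rewrite word_law0 eqxx mul1e esum1 ?adde0// => w /= /eqP.
  by rewrite word_law0 => /negbTE ->; rewrite mul0e.
rewrite cells_meanS//; last by move=> w; exact: kappa_ge0.
have -> : n.+1%:R * delta = delta + n%:R * delta.
  by rewrite mulrS mulrDl mul1r.
have nd0 : 0 <= n%:R * delta by rewrite mulr_ge0.
rewrite [RHS](word_lawD_esum q_ge0 delta_ge0 nd0 F0).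
by apply: eq_esum => w _; rewrite -ih.
Qed.

(** [word_lawD_esum] with two equal lengths merges each pair of neighbouring cells. *)
Lemma cells_mean_pair n (F : seq (seq M) -> \bar R) : (forall w, 0 <= F w)%E ->
  cells_mean (word_law q delta) n.*2 (fun c => F (pair_cells c)) =
  cells_mean (word_law q (delta + delta)) n F.
Proof.
have k0 w : 0 <= word_law q delta w by exact: kappa_ge0.
have k1 w : 0 <= word_law q (delta + delta) w by rewrite kappa_ge0 ?addr_ge0.
elim: n F => [|n ih] F F0; first by rewrite !cells_mean0.
rewrite doubleS !cells_meanS//.
rewrite [RHS](word_lawD_esum q_ge0 delta_ge0 delta_ge0); last first.
  by move=> w; apply: cells_mean_ge0.
apply: eq_esum => u _; rewrite cells_meanS//; congr (_ * _)%E.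
by apply: eq_esum => v _; rewrite -ih.
Qed.

End cells_word_law.

(** * The projective system of dyadic levels *)

Section levels.
Context {R : realType} {M : finType} (q : M -> R).
Hypothesis q_ge0 : forall u, 0 <= q u.
Hypothesis q_gt0 : 0 < total_rate q.
Context {Z : finType} (init : Z -> R).
Hypothesis init_ge0 : forall z, 0 <= init z.
Hypothesis init_sum1 : \sum_z init z = 1.

Definition mesh (m : nat) : R := (2 ^+ m)^-1.

Lemma mesh_gt0 m : 0 < mesh m.
Proof. by rewrite invr_gt0 exprn_gt0. Qed.

Lemma mesh_ge0 m : 0 <= mesh m. Proof. exact/ltW/mesh_gt0. Qed.

Lemma meshD m : mesh m.+1 + mesh m.+1 = mesh m.
Proof. by rewrite /mesh exprS invfM -mulrDl -[2^-1]mul1r -splitr mul1r. Qed.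

(* The state at level m is the initial state together with the words met in    *)
(* the first 4 ^ m cells of length 2 ^ - m, so that the horizon is 2 ^ m.      *)
Definition level_law (m : nat) (a : Z * seq (seq M)) : R :=
  init a.1 * cells_law (word_law q (mesh m)) (4 ^ m) a.2.

(** Pairing the [4 * 4 ^ m] cells of level [m.+1] leaves [2 * 4 ^ m] cells of the length used at
    level [m]; those beyond its horizon are dropped. *)
Definition level_proj (m : nat) (a : Z * seq (seq M)) : Z * seq (seq M) :=
  (a.1, take (4 ^ m) (pair_cells a.2)).

Let k0 m w : 0 <= word_law q (mesh m) w.
Proof. exact/word_law_ge0/mesh_ge0. Qed.

Lemma level_law_ge0 m a : 0 <= level_law m a.
Proof. by rewrite mulr_ge0// cells_law_ge0. Qed.

Lemma level_law_size m a : level_law m a != 0 -> size a.2 = (4 ^ m)%N.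
Proof. by rewrite mulf_eq0 negb_or => /andP[_ /cells_law_size]. Qed.

Lemma level_mean m (F : Z * seq (seq M) -> \bar R) : (forall a, 0 <= F a)%E ->
  (\esum_(a in [set: Z * seq (seq M)]) ((level_law m a)%:E * F a) =
   \sum_z (init z)%:E *
     cells_mean (word_law q (mesh m)) (4 ^ m) (fun c => F (z, c)))%E.
Proof.
move=> F0; rewrite -esum_finType => [|z]; last first.
  by rewrite mule_ge0 ?lee_fin//; apply: cells_mean_ge0.
under [RHS]eq_esum => z _.
  rewrite -ge0_esumZl//; last first.
    by move=> c; rewrite mule_ge0// lee_fin cells_law_ge0.
  over.
rewrite esum_esum/=; last first.
  by move=> z c _ _; rewrite !mule_ge0 ?lee_fin// cells_law_ge0.
rewrite (_ : _ `*`` _ = setT); last by apply/seteqP; split => // -[].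
by apply: eq_esum => -[z c] _; rewrite /level_law/= EFinM muleA.
Qed.

Lemma level_law_sum1 :
  \esum_(a in [set: Z * seq (seq M)]) (level_law 0 a)%:E = 1%E.
Proof.
under eq_esum do rewrite -[(level_law 0 _)%:E]mule1.
rewrite level_mean// -[RHS](congr1 EFin init_sum1) -sumEFin.
apply: eq_bigr => z _; rewrite cells_mean_cst ?mule1//.
exact/esum_word_law/mesh_ge0.
Qed.

(** Merging pairs gives twice the number of cells of level [m] ([cells_mean_pair]), and the surplus
    half is summed out ([cells_mean_take]). *)
Lemma level_law_proj m b :
  \esum_(a in [set: Z * seq (seq M)])
    (if level_proj m a == b then level_law m.+1 a else 0)%:E =
  (level_law m b)%:E.
Proof.
case: b => z c.
rewrite (@eq_esum _ _ _ _ (fun a =>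
    ((level_law m.+1 a)%:E * (level_proj m a == (z, c))%:R%:E)%E)); last first.
  by move=> a _; case: eqP; rewrite ?mule1 ?mule0.
rewrite level_mean => [|a]; last by rewrite lee_fin.
rewrite (bigD1 z)//= big1 ?adde0 => [|z' z'z]; last first.
  rewrite [X in (_ * X)%E]esum1 ?mule0// => d _.
  by rewrite /level_proj/= xpair_eqE (negbTE z'z) mule0.
rewrite /level_law/= EFinM; congr (_ * _)%E.
transitivity (cells_mean (word_law q (mesh m)) (4 ^ m).*2
    (fun d => (take (4 ^ m) d == c)%:R%:E)).
  rewrite -(meshD m) -[RHS]cells_mean_pair ?mesh_ge0//.
  rewrite (_ : (4 ^ m).*2.*2 = (4 ^ m.+1)%N); last first.
    by rewrite expnS -!mul2n mulnA.
  congr cells_mean; apply/funext => d.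
  by rewrite /level_proj/= xpair_eqE eqxx.
rewrite (@cells_mean_take _ _ _ _ _ (4 ^ m) (4 ^ m).*2 (fun d => (d == c)%:R))//.
- exact: cells_mean_law.
- exact/esum_word_law/mesh_ge0.
- by rewrite -addnn leq_addr.
Qed.

End levels.

(** * Paths: the word met up to a real time *)

Lemma nonincreasing_near_cst (u : nat -> nat) :
  (\forall m \near \oo, (u m.+1 <= u m)%N) ->
  exists v, \forall m \near \oo, u m = v.
Proof.
move=> [N _ uN].
have uhomo m : (N <= m)%N -> forall j, (u (m + j) <= u m)%N.
  move=> Nm; elim=> [|j ih]; first by rewrite addn0.
  by rewrite addnS (leq_trans _ ih)// uN//= (leq_trans Nm)// leq_addr.
(* The limit is the smallest value taken from [N] on. *)
pose V v := `[< exists2 m, (N <= m)%N & u m = v >].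
have exV : exists v, V v by exists (u N); apply/asboolP; exists N.
case: (ex_minnP exV) => v /asboolP[m0 Nm0 um0] vmin.
exists v; exists m0 => //= m m0m; apply/eqP; rewrite eqn_leq; apply/andP; split.
  by rewrite -um0 -(subnKC m0m) uhomo.
by apply: vmin; apply/asboolP; exists m => //; exact: leq_trans m0m.
Qed.

Lemma prefix_flatten_take (T : eqType) (c : seq (seq T)) i j : (i <= j)%N ->
  prefix (flatten (take i c)) (flatten (take j c)).
Proof.
move=> ij; rewrite -(cat_take_drop i (take j c)) take_takel//.
by rewrite flatten_cat prefix_prefix.
Qed.

Lemma prefix_size_eq (T : eqType) (s1 s2 : seq T) :
  prefix s1 s2 -> size s1 = size s2 -> s1 = s2.
Proof. by rewrite prefixE => /eqP s12 ss; rewrite -s12 ss take_size. Qed.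

Section paths.
Context {R : realType} {M Z : finType} (Y : nat -> Z * seq (seq M)).
Hypothesis Y_proj : forall m, level_proj m (Y m.+1) = Y m.
Hypothesis Y_size : forall m, size (Y m).2 = (4 ^ m)%N.
Implicit Types t u : R.

(* The cell that contains t is counted in full, hence the successor.           *)
Definition cover m t : nat := (Num.truncn (t * 2 ^+ m)).+1.

Definition word_upto m t : seq M := flatten (take (cover m t) (Y m).2).

Lemma le_cover m t u : t <= u -> (cover m t <= cover m u)%N.
Proof. by move=> tu; rewrite ltnS le_truncn// ler_wpM2r. Qed.

Lemma cover_double m t : 0 <= t -> (cover m.+1 t <= (cover m t).*2)%N.
Proof.
move=> t0; rewrite /cover truncn_lt_nat ?mulr_ge0// exprS mulrCA.
rewrite -mul2n natrM ltr_pM2l//.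
have t0' : 0 <= t * 2 ^+ m by rewrite mulr_ge0.
by case/andP: (truncn_itv t0').
Qed.

Lemma cover_fits m t : 0 <= t -> t < 2 ^+ m -> (cover m t <= 4 ^ m)%N.
Proof.
move=> t0 tm; rewrite /cover truncn_lt_nat ?mulr_ge0//.
rewrite (_ : (4 ^ m)%N = (2 ^ m * 2 ^ m)%N); last by rewrite -expnMn.
by rewrite natrM natrX ltr_pM2r// exprn_gt0.
Qed.

Lemma ltr_pow2_near t : \forall m \near \oo, t < 2 ^+ m.
Proof.
exists (Num.truncn `|t|).+1 => //= m tm.
apply: (le_lt_trans (ler_norm t)).
have /andP[_ tt] := truncn_itv (normr_ge0 t); apply: (lt_le_trans tt).
by rewrite -natrX ler_nat (leq_trans tm)// ltnW// ltn_expl.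
Qed.

(** Halving the cells can only shrink the region that covers [[0, t]] ([cover_double]), so the word
    loses letters at its end only. The bound on [t] keeps the cover within the horizon. *)
Lemma word_upto_prefix m t : 0 <= t -> t < 2 ^+ m ->
  prefix (word_upto m.+1 t) (word_upto m t).
Proof.
move=> t0 tm; have fit := cover_fits t0 tm.
rewrite {2}/word_upto -Y_proj/= take_takel// take_pair_cells flatten_pair_cells.
  exact/prefix_flatten_take/cover_double.
rewrite size_takel ?odd_double// Y_size expnS.
by rewrite -mul2n (_ : 4 = 2 * 2)%N// -mulnA leq_mul2l/= (leq_trans fit)// leq_pmull.
Qed.

Lemma word_upto_prefix_le m n t : 0 <= t -> t < 2 ^+ m -> (m <= n)%N ->
  prefix (word_upto n t) (word_upto m t).
Proof.
move=> t0 tm /subnKC <-; elim: (n - m)%N => [|j ih].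
  by rewrite addn0 prefix_refl.
rewrite addnS; apply: prefix_trans ih; apply: word_upto_prefix => //.
by rewrite (lt_le_trans tm)// ler_weXn2l ?ler1n ?leq_addr.
Qed.

(** Lengths decrease with the level, hence stabilize, and a prefix of equal length is the whole
    word. *)
Lemma word_upto_stable t : 0 <= t ->
  exists w, \forall m \near \oo, word_upto m t = w.
Proof.
move=> t0.
have [v sv] : exists v, \forall m \near \oo, size (word_upto m t) = v.
  apply: nonincreasing_near_cst; near=> m; apply/size_prefix/word_upto_prefix => //.
  by near: m; exact: ltr_pow2_near.
have [N _ Nv] : \forall m \near \oo, size (word_upto m t) = v /\ t < 2 ^+ m.
  by near=> m; split; near: m => //; exact: ltr_pow2_near.
exists (word_upto N t); exists N => //= m Nm.
apply: prefix_size_eq; last by rewrite (Nv m Nm).1 (Nv N (leqnn N)).1.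
by apply: word_upto_prefix_le => //; exact: (Nv N (leqnn N)).2.
Unshelve. all: by end_near. Qed.

(** For [t >= 0] the eventual word exists by [word_upto_stable], so the default is not reached. *)
Definition word_at t : seq M :=
  xget [::] [set w | \forall m \near \oo, word_upto m t = w].

Lemma word_atP t : 0 <= t -> \forall m \near \oo, word_upto m t = word_at t.
Proof.
move=> t0; have [w wP] := word_upto_stable t0.
exact: (@xgetPex _ [::] [set w | \forall m \near \oo, word_upto m t = w]
  (ex_intro _ w wP)).
Qed.

Lemma word_at_prefix t u : 0 <= t -> t <= u -> prefix (word_at t) (word_at u).
Proof.
move=> t0 tu; have u0 := le_trans t0 tu.
have [m [<- <-]] : exists m,
    word_upto m t = word_at t /\ word_upto m u = word_at u.
  apply: (@filter_ex _ (nbhs \oo)).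
  by near=> m; split; near: m; exact: word_atP.
exact/prefix_flatten_take/le_cover.
Unshelve. all: by end_near. Qed.

(** Take a level where the word up to [t] is final. A slightly later [u] lies in the same cell, so
    [word_at u] is a prefix of that final word; it also extends it. *)
Lemma word_at_right_continuous t : 0 <= t ->
  \forall u \near t^'+, word_at u = word_at t.
Proof.
move=> t0.
have [m [wm tm]] : exists m, word_upto m t = word_at t /\ t < 2 ^+ m.
  apply: (@filter_ex _ (nbhs \oo)).
  by near=> m; split; near: m; [exact: word_atP|exact: ltr_pow2_near].
have t0' : 0 <= t * 2 ^+ m by rewrite mulr_ge0.
have /andP[t1 t2] := truncn_itv t0'.
near=> u.
have tu : t <= u by apply/ltW; near: u; exact: nbhs_right_gt.
have u0 := le_trans t0 tu.
have um : cover m u = cover m t.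
  congr S; apply: truncn_def; rewrite (le_trans t1) ?ler_wpM2r//=.
  rewrite -ltr_pdivlMr ?exprn_gt0//; near: u; apply: nbhs_right_lt.
  by rewrite ltr_pdivlMr ?exprn_gt0.
have u2m : u < 2 ^+ m by near: u; exact: nbhs_right_lt.
have uE : prefix (word_at u) (word_upto m u).
  have [n [<- mn]] : exists n, word_upto n u = word_at u /\ (m <= n)%N.
    apply: (@filter_ex _ (nbhs \oo)).
    by near=> n; split; near: n; [exact: word_atP|exists m].
  exact: word_upto_prefix_le.
have := word_at_prefix t0 tu; rewrite -wm in uE *.
move: uE; rewrite /word_upto um => ut tu'; apply: (prefix_size_eq ut).
by apply/eqP; rewrite eqn_leq !size_prefix.
Unshelve. all: by end_near. Qed.

End paths.

(** * Continuous-time processes driven by words *)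

Section near_events.
Context {R : realType} {d} {Omega : measurableType d} (P : probability Omega R).
Context (A_ : nat -> set Omega) (A : set Omega).
Hypothesis mA_ : forall m, measurable (A_ m).
Hypothesis near_A : forall w, \forall m \near \oo, A_ m w <-> A w.

Let inner n := \bigcap_(m in [set m | (n <= m)%N]) A_ m.
Let outer n := \bigcup_(m in [set m | (n <= m)%N]) A_ m.

Let bigcup_inner : \bigcup_n inner n = A.
Proof.
apply/seteqP; split => w.
  move=> [n _ wn]; have [m [nm Aw]] : exists m, (n <= m)%N /\ (A_ m w <-> A w).
    apply: (@filter_ex _ (nbhs \oo)).
    by near=> m; split; near: m; [exists n|exact: near_A].
  exact/Aw/wn.
by have [n _ Aw] := near_A w => wA; exists n => // m nm; apply/(Aw m nm).
Unshelve. all: by end_near. Qed.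

Let bigcap_outer : \bigcap_n outer n = A.
Proof.
apply/seteqP; split => w.
  move=> wA; have [n _ Aw] := near_A w.
  by have [m /= nm] := wA n I; move/(Aw m nm).
move=> wA n _; have [m [nm Aw]] : exists m, (n <= m)%N /\ (A_ m w <-> A w).
  apply: (@filter_ex _ (nbhs \oo)).
  by near=> m; split; near: m; [exists n|exact: near_A].
by exists m => //; apply/Aw.
Unshelve. all: by end_near. Qed.

Let m_inner n : measurable (inner n).
Proof. by apply: bigcap_measurable; [exists n => /=|]. Qed.

Let m_outer n : measurable (outer n).
Proof. exact: bigcup_measurable. Qed.

Lemma measurable_near : measurable A.
Proof. by rewrite -bigcup_inner; exact: bigcupT_measurable. Qed.

(** Squeeze between [inner], increasing to [A], and [outer], decreasing to [A]. *)
Lemma prob_near : P (A_ m) @[m --> \oo] --> P A.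
Proof.
apply: (@squeeze_cvge _ _ _ _ (P \o inner) _ (P \o outer)).
- near=> m; apply/andP; split; apply: le_measure; rewrite ?inE//.
    by move=> w wm; apply: wm => /=.
  by move=> w Aw; exists m => /=.
- rewrite -[in X in _ --> X]bigcup_inner; apply: nondecreasing_cvg_mu => //.
    exact: bigcupT_measurable.
  move=> m n mn; apply/subsetPset => w wm k /= nk.
  by apply: wm => /=; exact: leq_trans nk.
- rewrite -[in X in _ --> X]bigcap_outer; apply: nonincreasing_cvg_mu => //.
  + by rewrite (le_lt_trans (probability_le1 _ _)) ?ltry.
  + exact: bigcapT_measurable.
  + move=> m n mn; apply/subsetPset => w [k /= nk wk].
    by exists k => //=; exact: leq_trans nk.
Unshelve. all: by end_near. Qed.

End near_events.

Section cells_markov.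
Context {R : realType} {M : finType} (q : M -> R).
Hypothesis q_ge0 : forall u, 0 <= q u.
Hypothesis q_gt0 : 0 < total_rate q.
Context {S : finType} (f : S -> M -> S) (delta : R) (delta_ge0 : 0 <= delta).

Let kappa := word_law q delta.
Let kappa_ge0 w : 0 <= kappa w. Proof. exact: word_law_ge0. Qed.
Let kappa_sum1 : \esum_(w in [set: seq M]) (kappa w)%:E = 1%E.
Proof. exact: esum_word_law. Qed.

Definition state_in (x : S) (c : seq (seq M)) (k : nat) : S :=
  foldl f x (flatten (take k c)).

Lemma cells_mean_state N k x y : (k <= N)%N ->
  cells_mean kappa N (fun c => (state_in x c k == y)%:R%:E) =
  (driven_trans q f (k%:R * delta) x y)%:E.
Proof.
move=> kN; rewrite (@cells_mean_take _ _ kappa kappa_ge0 kappa_sum1 k N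
  (fun c => (foldl f x (flatten c) == y)%:R))//.
rewrite (@cells_mean_flatten _ _ q q_ge0 _ delta_ge0 k
  (fun w => (foldl f x w == y)%:R%:E)) => [|w]; last by rewrite lee_fin.
by rewrite driven_transE// mulr_ge0.
Qed.

(** The past event depends on the first [k n] cells only; the next ones are independent of them and
    move the chain according to [cells_mean_state]. *)
Lemma cells_markov N n (k : nat -> nat) (s : nat -> S) x :
  (forall i, (i <= n)%N -> (k i <= k i.+1)%N) -> (k n.+1 <= N)%N ->
  (cells_mean kappa N (fun c =>
     (`[< forall i, (i <= n.+1)%N -> state_in x c (k i) = s i >])%:R%:E) =
   cells_mean kappa N (fun c =>
     (`[< forall i, (i <= n)%N -> state_in x c (k i) = s i >])%:R%:E) *
   (driven_trans q f ((k n.+1 - k n)%:R * delta) (s n) (s n.+1))%:E)%E.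
Proof.
move=> kS kN; pose G n c :=
  `[< forall i, (i <= n)%N -> state_in x c (k i) = s i >].
have k_le i j : (i <= j)%N -> (j <= n.+1)%N -> (k i <= k j)%N.
  move=> /subnKC <-; elim: (j - i)%N => [|l ih]; first by rewrite addn0.
  by rewrite addnS => iln; rewrite (leq_trans (ih (ltnW iln)))// kS.
have G_take j c a : (j <= n.+1)%N -> (k j <= a)%N -> G j (take a c) = G j c.
  move=> jn kja; apply: asbool_equiv_eq; split => + i ij => /(_ i ij);
  by rewrite /state_in take_takel// (leq_trans (k_le _ _ ij jn)).
have GS c : G n.+1 c = G n c && (state_in x c (k n.+1) == s n.+1).
  apply/asboolP/andP => [Gc|[/asboolP Gc /eqP cn] i].
    by split; [apply/asboolP => i ni; exact/Gc/leqW|exact/eqP/Gc].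
  by rewrite leq_eqVlt ltnS => /predU1P[->//|]; exact: Gc.
(* An event about the first [k j] cells can be computed with horizon [k j]. *)
have red j : (j <= n.+1)%N -> cells_mean kappa N (fun c => (G j c)%:R%:E) =
    cells_mean kappa (k j) (fun c => (G j c)%:R%:E).
  move=> jn; rewrite -(@cells_mean_take _ _ kappa kappa_ge0 kappa_sum1 (k j) N
    (fun c => (G j c)%:R))//; last exact: leq_trans (k_le _ _ jn (leqnn _)) kN.
  by congr cells_mean; apply/funext => c; rewrite G_take.
rewrite -/(G n.+1) -/(G n) !red//.
set b := (k n.+1 - k n)%N.
have kb : k n.+1 = (k n + b)%N by rewrite subnKC// kS.
rewrite [in LHS]kb cells_meanD// muleC -cells_meanZl//; last first.
- by apply: driven_trans_ge0 => //; rewrite mulr_ge0.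
apply: eq_cells_mean => u un.
rewrite -(@cells_mean_state b b)// muleC -cells_meanZl//.
apply: eq_cells_mean => v vb.
rewrite GS /state_in kb.
have -> : (k n + b)%N = size (u ++ v) by rewrite size_cat un vb.
rewrite take_size.
rewrite flatten_cat foldl_cat (_ : G n (u ++ v) = G n u); last first.
  by rewrite -[in RHS](take_size_cat v un) G_take.
case: (boolP (G n u)) => [/asboolP Gu|_]; last by rewrite mul0e.
rewrite -[b in take b v]vb take_size.
by rewrite mul1e -(Gu n (leqnn n)) /state_in -un take_size.
Qed.

End cells_markov.

Section cover_limit.
Context {R : realType}.
Implicit Types t u : R.

Lemma mesh_cvg0 : mesh m @[m --> \oo] --> (0 : R).
Proof.
rewrite (_ : mesh = GRing.exp (2^-1 : R)); last first.
  by apply/funext => m; rewrite /mesh exprVn.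
by apply: cvg_expr; rewrite ger0_norm// invf_lt1// ltr1n.
Qed.

Lemma cover_mesh_cvg t : 0 <= t -> (cover m t)%:R * mesh m @[m --> \oo] --> t.
Proof.
move=> t0; apply: (@squeeze_cvgr _ _ _ _ (fun=> t) (fun m => t + mesh m)).
- near=> m; have tm0 : 0 <= t * 2 ^+ m by rewrite mulr_ge0.
  have /andP[t1 t2] := truncn_itv tm0.
  rewrite /mesh ler_pdivlMr ?exprn_gt0// ltW//=.
  rewrite ler_pdivrMr ?exprn_gt0// mulrDl mulVf ?gt_eqF ?exprn_gt0//.
  by rewrite /cover -natr1 lerD2r.
- exact: cvg_cst.
- by rewrite -[X in _ --> X]addr0; apply: cvgD; [exact: cvg_cst|exact: mesh_cvg0].
Unshelve. all: by end_near. Qed.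

Lemma coverB_mesh_cvg t u : 0 <= t -> t <= u ->
  (cover m u - cover m t)%:R * mesh m @[m --> \oo] --> u - t.
Proof.
move=> t0 tu; under eq_fun do rewrite natrB ?le_cover// mulrBl.
by apply: cvgB; apply: cover_mesh_cvg => //; exact: le_trans tu.
Qed.

End cover_limit.

Section driven_trans_limit.
Context {R : realType} {M : finType} (q : M -> R).
Hypothesis q_ge0 : forall u, 0 <= q u.
Hypothesis q_gt0 : 0 < total_rate q.
Context {S : finType} (f : S -> M -> S).

Lemma driven_trans_cvg (a : nat -> R) (b : R) x y :
  (forall m, 0 <= a m) -> 0 <= b -> a m @[m --> \oo] --> b ->
  driven_trans q f (a m) x y @[m --> \oo] --> driven_trans q f b x y.
Proof.
have lip s t : 0 <= s -> 0 <= t -> `|driven_trans q f s x y -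
    driven_trans q f t x y| <= total_rate q * `|s - t|.
  wlog st : s t / s <= t.
    move=> H s0 t0; have [/H|/ltW/H] := leP s t; first exact.
    by rewrite distrC (distrC t); exact.
  move=> s0 t0; rewrite distrC (distrC s) (ger0_norm (x := t - s)) ?subr_ge0//.
  rewrite -{1}(subrKC s t); apply: driven_trans_lip => //.
  by rewrite subr_ge0.
move=> a0 b0 /cvgrPdist_le ab; apply/cvgrPdist_le => e e0.
have e0' : 0 < e / total_rate q by rewrite divr_gt0.
near=> m; apply: (le_trans (lip _ _ b0 (a0 m))).
by rewrite mulrC -ler_pdivlMr//; near: m; exact: ab.
Unshelve. all: by end_near. Qed.

End driven_trans_limit.

Section driven_process.
Context {R : realType} {M : finType} (q : M -> R).
Hypothesis q_ge0 : forall u, 0 <= q u.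
Hypothesis q_gt0 : 0 < total_rate q.
Context {Z : finType} (init : Z -> R).
Hypothesis init_ge0 : forall z, 0 <= init z.
Hypothesis init_sum1 : \sum_z init z = 1.
Context {d} {Omega : measurableType d} (P : probability Omega R).
Context (Y : Omega -> nat -> Z * seq (seq M)).
Hypothesis Y_proj : forall w m, level_proj m (Y w m.+1) = Y w m.
Hypothesis Y_size : forall w m, size (Y w m).2 = (4 ^ m)%N.
Hypothesis mY : forall m a, measurable [set w | Y w m = a].
Hypothesis PY : forall m a, P [set w | Y w m = a] = (level_law q init m a)%:E.
Context {S : finType} (f : S -> M -> S) (phi : Z -> S).

Let Y1 w m : (Y w m).1 = (Y w 0%N).1.
Proof. by elim: m => // m <-; rewrite -[in RHS]Y_proj. Qed.

(** [phi] reads the start of one automaton off the common initial state, which is the same at all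
    levels by [Y1]; thus several chains can share [Y]. *)
Definition driven_state (t : R) (w : Omega) : S :=
  foldl f (phi (Y w 0%N).1) (word_at (Y w) t).

Definition driven_state_upto (m : nat) (t : R) (w : Omega) : S :=
  state_in f (phi (Y w m).1) (Y w m).2 (cover m t).

Lemma driven_state_upto_near t w : 0 <= t ->
  \forall m \near \oo, driven_state_upto m t w = driven_state t w.
Proof.
move=> t0; near=> m; rewrite /driven_state_upto /driven_state /state_in Y1.
rewrite -[flatten _]/(word_upto (Y w) m t); congr foldl.
by near: m; exact: word_atP.
Unshelve. all: by end_near. Qed.

Lemma driven_state_right_continuous : right_continuous_paths driven_state.
Proof.
move=> w t t0; near=> u; rewrite /driven_state; congr foldl.
by near: u; exact: word_at_right_continuous.
Unshelve. all: by end_near. Qed.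

Lemma level_prob m (A : set (Z * seq (seq M))) :
  P [set w | A (Y w m)] =
  (\sum_z (init z)%:E * cells_mean (word_law q (mesh m)) (4 ^ m)
     (fun c => (`[< A (z, c) >])%:R%:E))%E.
Proof.
rewrite (prob_discrete (mY m) (PY m)).
rewrite esum_mkcond -(@level_mean _ _ q q_ge0 _ init init_ge0 m
  (fun a => (`[< A a >])%:R%:E)) => [|a]; last by rewrite lee_fin.
apply: eq_esum => a _; case: asboolP => Aa.
  by rewrite mem_set// mule1.
by rewrite memNset// mule0.
Qed.

Lemma level_state_prob m t y : (cover m t <= 4 ^ m)%N ->
  P [set w | driven_state_upto m t w = y] =
  (\sum_z init z *
    driven_trans q f ((cover m t)%:R * mesh m) (phi z) y)%:E.
Proof.
move=> fit; rewrite (level_prob m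
  [set a | state_in f (phi a.1) a.2 (cover m t) = y]) -sumEFin.
apply: eq_bigr => z _; rewrite EFinM -(cells_mean_state q_ge0 _ _ _ _ _ fit)//.
  congr (_ * _)%E; apply: eq_cells_mean => c _; congr ((nat_of_bool _)%:R%:E).
  by apply/asboolP/eqP.
exact: mesh_ge0.
Qed.

Lemma level_markov m n (t : nat -> R) (s : nat -> S) :
  (forall i, (i <= n)%N -> t i <= t i.+1) -> (cover m (t n.+1) <= 4 ^ m)%N ->
  P [set w | forall i, (i <= n.+1)%N -> driven_state_upto m (t i) w = s i] =
  (P [set w | forall i, (i <= n)%N -> driven_state_upto m (t i) w = s i] *
   (driven_trans q f ((cover m (t n.+1) - cover m (t n))%:R * mesh m)
     (s n) (s n.+1))%:E)%E.
Proof.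
move=> tS fit; pose A j := [set a : Z * seq (seq M) | forall i, (i <= j)%N ->
  state_in f (phi a.1) a.2 (cover m (t i)) = s i].
rewrite (level_prob m (A n.+1)) (level_prob m (A n)) ge0_sume_distrl => [|z _].
  apply: eq_bigr => z _; rewrite -muleA; congr (_ * _)%E.
  have kS i : (i <= n)%N -> (cover m (t i) <= cover m (t i.+1))%N.
    by move=> ni; exact/le_cover/tS.
  exact: (@cells_markov _ _ q q_ge0 q_gt0 _ f (mesh m) (mesh_ge0 m) (4 ^ m) n
    (fun i => cover m (t i)) s (phi z) kS fit).
rewrite mule_ge0 ?lee_fin//; apply: cells_mean_ge0 => // w.
exact/word_law_ge0/mesh_ge0.
Qed.

Let near_states n (t : nat -> R) (s : nat -> S) w :
  (forall i, (i <= n)%N -> 0 <= t i) -> \forall m \near \oo,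
  (forall i, (i <= n)%N -> driven_state_upto m (t i) w = s i) <->
  (forall i, (i <= n)%N -> driven_state (t i) w = s i).
Proof.
move=> t0; have : \forall m \near \oo, forall i : 'I_n.+1,
    driven_state_upto m (t i) w = driven_state (t i) w.
  apply: filter_forall => i; apply: driven_state_upto_near.
  by apply: t0; rewrite -ltnS.
apply: filterS => m E; split => Es i ni.
  by rewrite -(E (Ordinal (ni : (i < n.+1)%N)))/= Es.
by rewrite (E (Ordinal (ni : (i < n.+1)%N)))/= Es.
Qed.

Let measurable_upto m (A : set (Z * seq (seq M))) :
  measurable [set w | A (Y w m)].
Proof. exact: measurable_discrete. Qed.

Let measurable_states_upto m n (t : nat -> R) (s : nat -> S) : measurable
  [set w | forall i, (i <= n)%N -> driven_state_upto m (t i) w = s i].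
Proof.
exact: (measurable_upto m [set a | forall i, (i <= n)%N ->
  state_in f (phi a.1) a.2 (cover m (t i)) = s i]).
Qed.

Let measurable_states n (t : nat -> R) (s : nat -> S) :
  (forall i, (i <= n)%N -> 0 <= t i) ->
  measurable [set w | forall i, (i <= n)%N -> driven_state (t i) w = s i].
Proof.
move=> t0; apply: measurable_near => [m|w]; last exact: near_states t0.
exact: measurable_states_upto.
Qed.

Let states_prob_cvg n (t : nat -> R) (s : nat -> S) :
  (forall i, (i <= n)%N -> 0 <= t i) ->
  P [set w | forall i, (i <= n)%N -> driven_state_upto m (t i) w = s i]
    @[m --> \oo] -->
  P [set w | forall i, (i <= n)%N -> driven_state (t i) w = s i].
Proof.
move=> t0; apply: prob_near => [m|w]; last exact: near_states.
exact: measurable_states_upto.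
Qed.

Lemma measurable_driven_state t x : 0 <= t ->
  measurable [set w | driven_state t w = x].
Proof.
move=> t0.
apply: (measurable_near (A_ := fun m => [set w | driven_state_upto m t w = x])).
  move=> m; exact: (measurable_upto m
    [set a | state_in f (phi a.1) a.2 (cover m t) = x]).
by move=> w; apply: filterS (driven_state_upto_near w t0) => m /= ->.
Qed.

(** The identity is exact on every grid whose horizon exceeds the last time ([level_markov]). Both
    sides converge, by [states_prob_cvg] and [driven_trans_cvg], and limits are unique. *)
Lemma driven_markov : markov_with P driven_state (driven_trans q f).
Proof.
move=> n t s t00 tS.
have t_ge0 i : (i <= n.+1)%N -> 0 <= t i.
  by elim: i => // i ih ni; apply: (le_trans (ih (ltnW ni))); exact: tS.
have [t0n tn] : 0 <= t n /\ t n <= t n.+1 by split; [exact: t_ge0|exact: tS].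
rewrite -(cvg_lim _ (@states_prob_cvg n.+1 t s t_ge0))//; apply: cvg_lim => //.
have cover_fit : \forall m \near \oo, (cover m (t n.+1) <= 4 ^ m)%N.
  near=> m; apply: cover_fits; first exact: t_ge0.
  by near: m; exact: ltr_pow2_near.
apply: cvg_trans (_ : (P [set w | forall i, (i <= n)%N ->
    driven_state_upto m (t i) w = s i] *
  (driven_trans q f ((cover m (t n.+1) - cover m (t n))%:R * mesh m)
     (s n) (s n.+1))%:E)%E @[m --> \oo] --> _).
  apply: near_eq_cvg; near=> m; rewrite level_markov//.
  by near: m.
apply: cvgeM.
- rewrite mule_def_fin// fin_num_measure//; apply: measurable_states => i ni.
  exact/t_ge0/leqW.
- by apply: states_prob_cvg => i ni; exact/t_ge0/leqW.
- apply: cvg_EFin; first exact: nearW.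
  apply: driven_trans_cvg => //; [|by rewrite subr_ge0|exact: coverB_mesh_cvg].
  by move=> m; rewrite mulr_ge0// mesh_ge0.
Unshelve. all: by end_near. Qed.

Lemma driven_prob t y : 0 <= t -> P [set w | driven_state t w = y] =
  (\sum_z init z * driven_trans q f t (phi z) y)%:E.
Proof.
move=> t0.
have cvP : P [set w | driven_state_upto m t w = y] @[m --> \oo] -->
    P [set w | driven_state t w = y].
  apply: prob_near => [m|w].
    exact: (measurable_upto m
      [set a | state_in f (phi a.1) a.2 (cover m t) = y]).
  by apply: filterS (driven_state_upto_near w t0) => m /= ->.
rewrite -(cvg_lim _ cvP)//; apply: cvg_lim => //.
apply: cvg_trans (_ : (\sum_z init z *
    driven_trans q f ((cover m t)%:R * mesh m) (phi z) y)%:E @[m --> \oo] --> _).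
  apply: near_eq_cvg; near=> m; rewrite level_state_prob//.
  by apply: cover_fits => //; near: m; exact: ltr_pow2_near.
apply: cvg_EFin; first exact: nearW.
apply: cvg_big => [|z _]; first exact: add_continuous.
apply: cvgM; first exact: cvg_cst.
apply: driven_trans_cvg => //; [|exact: cover_mesh_cvg].
by move=> m; rewrite mulr_ge0// mesh_ge0.
Unshelve. all: by end_near. Qed.

Lemma driven_ctmc (r : S -> S -> R) :
  (forall x y, x != y -> r x y = driven_rate q f x y) ->
  is_ctmc P r driven_state.
Proof.
move=> rE; split.
- exact: measurable_driven_state.
- exact: driven_state_right_continuous.
- exists (driven_trans q f); split.
  + exact: driven_transP.
  + by move=> x y xy; rewrite rE//; exact: driven_has_rates.
  + exact: driven_markov.
Qed.

End driven_process.

(** The space, [z] and [W] are chosen before the automaton: this order of quantifiers is what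
    couples all driven chains. *)
Lemma driving_words_exist (R : realType) (M Z : finType) (q : M -> R)
    (init : Z -> R) : (forall u, 0 <= q u) -> 0 < total_rate q ->
    (forall z, 0 <= init z) -> \sum_z init z = 1 ->
  exists (d : measure_display) (Omega : measurableType d)
    (P : probability Omega R) (z : Omega -> Z) (W : R -> Omega -> seq M),
  [/\ forall w t u, 0 <= t -> t <= u -> prefix (W t w) (W u w),
      forall (S : finType) (f : S -> M -> S) (phi : Z -> S) (r : S -> S -> R),
        (forall x y, x != y -> r x y = driven_rate q f x y) ->
        is_ctmc P r (fun t w => foldl f (phi (z w)) (W t w))
    & forall (S : finType) (f : S -> M -> S) (phi : Z -> S) t y, 0 <= t ->
        P [set w | foldl f (phi (z w)) (W t w) = y] =
        (\sum_z init z * driven_trans q f t (phi z) y)%:E].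
Proof.
move=> q0 q1 i0 i1.
have nu0 m a := level_law_ge0 q0 i0 m a.
have nu1 := level_law_sum1 q0 q1 i0 i1.
have nuS m b := level_law_proj q0 q1 i0 m b.
pose Y (w : R) m := proj_var nu0 nu1 nuS m w.
exists _, (measurableTypeR R), (uniform_prob (@ltr01 R)).
exists (fun w => (Y w 0%N).1), (fun t w => word_at (Y w) t).
have Y_proj w m : level_proj m (Y w m.+1) = Y w m by exact: proj_varS.
have Y_size w m : size (Y w m).2 = (4 ^ m)%N.
  exact/(@level_law_size _ _ q _ init)/proj_var_neq0.
have mY m a : measurable [set w | Y w m = a] by exact: measurable_proj_var.
have PY m a : uniform_prob (@ltr01 R) [set w | Y w m = a] =
    (level_law q init m a)%:E by exact: prob_proj_var.
split => [w t u t0 tu|S f phi r rE|S f phi t y t0].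
- exact: word_at_prefix.
- exact: (@driven_ctmc _ _ q q0 q1 _ init i0 _ _ (uniform_prob (@ltr01 R))
    Y Y_proj Y_size mY PY S f phi r rE).
- exact: (@driven_prob _ _ q q0 q1 _ init i0 _ _ (uniform_prob (@ltr01 R))
    Y Y_proj Y_size mY PY S f phi t y t0).
Qed.

(** * The coupling of the four queues *)

(* Marks are pairs of booleans: (true, _) is an arrival, with the second       *)
(* component breaking ties, and (false, b) is a departure, from the longer     *)
(* queue if b and from the shorter one otherwise.                              *)
Definition mark_rate (R : realType) (rho : R) (u : bool * bool) : R :=
  if u.1 then rho else 1.

Lemma total_mark_rate_gt0 (R : realType) (rho : R) : 0 < rho ->
  0 < total_rate (mark_rate rho).
Proof.
move=> rho0; rewrite /total_rate (bigD1 (true, true))//= ltr_pwDl//.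
by apply: sumr_ge0 => -[[] b] _; rewrite /mark_rate//= ltW.
Qed.

Lemma driven_rate_marks (R : realType) (rho : R) (S : finType)
    (f : S -> bool * bool -> S) (x y : S) :
  driven_rate (mark_rate rho) f x y =
  (f x (true, true) == y)%:R * rho + (f x (true, false) == y)%:R * rho +
  ((f x (false, true) == y)%:R + (f x (false, false) == y)%:R).
Proof.
rewrite /driven_rate big_mkcond/=.
rewrite (eq_bigr (fun u => (f x u == y)%:R * mark_rate rho u)); last first.
  by move=> u _; case: eqP; rewrite ?mul1r ?mul0r.
rewrite (eq_bigr (fun u => (fun a b => (f x (a, b) == y)%:R *
  mark_rate rho (a, b)) u.1 u.2)) => [|[]//].
rewrite -(pair_bigA _ (fun a b => (f x (a, b) == y)%:R *
  mark_rate rho (a, b)))/= !big_bool /mark_rate/=.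
by rewrite !mulr1.
Qed.

(** The truncation at [m] is the loss of an arrival; in [decr_ord], [0.-1 = 0] makes the service of
    an empty queue idle. *)
Definition incr_ord (m : nat) (i : 'I_m.+1) : 'I_m.+1 := inord (minn i.+1 m).
Definition decr_ord (m : nat) (i : 'I_m.+1) : 'I_m.+1 := inord i.-1.

Lemma incr_ordE m (i : 'I_m.+1) : incr_ord i = minn i.+1 m :> nat.
Proof. by rewrite inordK// ltnS geq_minr. Qed.

Lemma decr_ordE m (i : 'I_m.+1) : decr_ord i = i.-1 :> nat.
Proof. by rewrite inordK// ltnS (leq_trans (leq_pred _))// -ltnS. Qed.

(** [u.2] is added as 0 or 1, so on a tie it sends the arrival to queue 2 or 1 respectively. For
    departures, on a tie queue 1 counts as the longer one and queue 2 as the shorter. *)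
Definition jsq_step (K : nat) (x : 'I_K.+1 * 'I_K.+1) (u : bool * bool) :=
  if u.1 then
    if (x.1 < x.2 + u.2)%N then (incr_ord x.1, x.2) else (x.1, incr_ord x.2)
  else
    if (x.2 <= x.1)%N == u.2 then (decr_ord x.1, x.2) else (x.1, decr_ord x.2).

Definition mm1_step (m : nat) (i : 'I_m.+1) (u : bool * bool) :=
  if u.1 then incr_ord i else decr_ord i.

Definition mm2_step (m : nat) (i : 'I_m.+1) (u : bool * bool) :=
  if u.1 then incr_ord i
  else if u.2 || (1 < i)%N then decr_ord i else i.

(** Blocked arrivals and idle services are excluded by [i != j]; the two marks of each kind add up
    to [2 * rho] and 2. *)
Lemma mm1_rate (R : realType) (rho : R) (m : nat) (i j : 'I_m.+1) : i != j ->
  mmcm_rate (2 * rho) 2 1 i j = driven_rate (mark_rate rho) (@mm1_step m) i j.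
Proof.
rewrite driven_rate_marks /mmcm_rate /mm1_step/= -!val_eqE/= incr_ordE decr_ordE.
have := ltn_ord i; have := ltn_ord j.
move: (i : nat) (j : nat) => {}i {}j jm im ij.
case: ifPn => j1.
  have -> : (minn i.+1 m == j) = true by lia.
  have -> : (i.-1 == j) = false by lia.
  by rewrite /=; ring.
have -> : (minn i.+1 m == j) = false by lia.
case: ifPn => j2.
  have -> : (i.-1 == j) = true by lia.
  have -> : minn i 1 = 1%N by lia.
  by rewrite /=; ring.
have -> : (i.-1 == j) = false by lia.
by rewrite /=; ring.
Qed.

Lemma mm2_rate (R : realType) (rho : R) (m : nat) (i j : 'I_m.+1) : i != j ->
  mmcm_rate (2 * rho) 1 2 i j = driven_rate (mark_rate rho) (@mm2_step m) i j.
Proof.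
move=> ij; rewrite driven_rate_marks /mmcm_rate /mm2_step/= (fun_if (eq_op^~ j)).
rewrite (negbTE ij); move: ij; rewrite -!val_eqE/= incr_ordE decr_ordE.
have := ltn_ord i; have := ltn_ord j.
move: (i : nat) (j : nat) => {}i {}j jm im ij.
case: ifPn => j1.
  have -> : (minn i.+1 m == j) = true by lia.
  have -> : (i.-1 == j) = false by lia.
  by rewrite if_same /=; ring.
have -> : (minn i.+1 m == j) = false by lia.
case: ifPn => j2.
  have -> : (i.-1 == j) = true by lia.
  case: ifPn => i1.
    have -> : minn i 2 = 2%N by lia.
    by rewrite /=; ring.
  have -> : minn i 2 = 1%N by lia.
  by rewrite /=; ring.
have -> : (i.-1 == j) = false by lia.
by rewrite if_same /=; ring.
Qed.

(** On a tie the two arrival marks choose different queues, which gives [rho] each; otherwise both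
    choose the shorter one. Each departure mark serves a different queue. *)
Lemma jsq_step_rate (R : realType) (rho : R) (K : nat)
    (x y : 'I_K.+1 * 'I_K.+1) : x != y ->
  jsq_rate rho x y = driven_rate (mark_rate rho) (@jsq_step K) x y.
Proof.
case: x y => [i j] [i' j'] xy; rewrite driven_rate_marks /jsq_rate /jsq_step/=.
rewrite !(fun_if (eq_op^~ (i', j'))) eqbF_neg eqb_id addn0 addn1 ltnS.
move: xy; rewrite !xpair_eqE -!val_eqE/= !incr_ordE !decr_ordE /join_rate.
have := ltn_ord i; have := ltn_ord j; have := ltn_ord i'; have := ltn_ord j'.
move: (i : nat) (j : nat) (i' : nat) (j' : nat) => {}i {}j {}i' {}j'.
move=> j'K i'K jK iK xy.
case: ifPn => [e|e1].
  have -> : (minn i.+1 K == i') && (j == j') = true by lia.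
  have -> : (i == i') && (minn j.+1 K == j') = false by lia.
  have -> : (i.-1 == i') && (j == j') = false by lia.
  have -> : (i == i') && (j.-1 == j') = false by lia.
  by case: (ltngtP i j) => ij /=; ring.
case: ifPn => [e|e2].
  have -> : (minn i.+1 K == i') && (j == j') = false by lia.
  have -> : (i == i') && (minn j.+1 K == j') = true by lia.
  have -> : (i.-1 == i') && (j == j') = false by lia.
  have -> : (i == i') && (j.-1 == j') = false by lia.
  by case: (ltngtP i j) => ij /=; ring.
case: ifPn => [e|e3].
  have -> : (minn i.+1 K == i') && (j == j') = false by lia.
  have -> : (i == i') && (minn j.+1 K == j') = false by lia.
  have -> : (i.-1 == i') && (j == j') = true by lia.
  have -> : (i == i') && (j.-1 == j') = false by lia.
  by case: (ltngtP i j) => ij /=; ring.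
case: ifPn => [e|e4].
  have -> : (minn i.+1 K == i') && (j == j') = false by lia.
  have -> : (i == i') && (minn j.+1 K == j') = false by lia.
  have -> : (i.-1 == i') && (j == j') = false by lia.
  have -> : (i == i') && (j.-1 == j') = true by lia.
  by case: (ltngtP i j) => ij /=; ring.
have -> : (minn i.+1 K == i') && (j == j') = false by lia.
have -> : (i == i') && (minn j.+1 K == j') = false by lia.
have -> : (i.-1 == i') && (j == j') = false by lia.
have -> : (i == i') && (j.-1 == j') = false by lia.
by rewrite !if_same /=; ring.
Qed.

Definition ordered_counts (K : nat) (x : 'I_K.+1 * 'I_K.+1) (up : 'I_K.+1)
    (low lowlow : 'I_(2 * K).+1) :=
  [/\ (lowlow <= low)%N, (low <= x.1 + x.2)%N & (x.1 + x.2 <= K + up)%N].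

Lemma ordered_counts_step (K : nat) (x : 'I_K.+1 * 'I_K.+1) (up : 'I_K.+1)
    (low lowlow : 'I_(2 * K).+1) (u : bool * bool) :
  ordered_counts x up low lowlow ->
  ordered_counts (jsq_step x u) (mm1_step up u) (mm2_step low u)
    (mm1_step lowlow u).
Proof.
case: x u => [i j] [a b] [/= ll_l l_ij ij_up].
(* The capacity bounds settle the cases of a blocked arrival and of a service wasted on an empty
   queue. *)
have := ltn_ord i; have := ltn_ord j; have := ltn_ord up; have := ltn_ord low.
rewrite /ordered_counts /jsq_step /mm1_step /mm2_step/= => lowK upK jK iK.
case: a; first by case: b; case: ifPn => ij /=; rewrite !incr_ordE; split; lia.
by case: b => /=; do ?[case: ifPn => ?]; rewrite /= !decr_ordE; split; lia.
Qed.

Lemma ordered_counts_foldl (K : nat) (x : 'I_K.+1 * 'I_K.+1) (up : 'I_K.+1)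
    (low lowlow : 'I_(2 * K).+1) (w : seq (bool * bool)) :
  ordered_counts x up low lowlow ->
  ordered_counts (foldl (@jsq_step K) x w) (foldl (@mm1_step K) up w)
    (foldl (@mm2_step (2 * K)) low w) (foldl (@mm1_step (2 * K)) lowlow w).
Proof.
elim: w x up low lowlow => //= u w ih x up low lowlow xo.
by apply: ih; exact: ordered_counts_step.
Qed.

(** Reading the four queues as one automaton gives access to their joint law at time 0. *)
Definition joint_step (K : nat)
    (s : ('I_K.+1 * 'I_K.+1) * 'I_K.+1 * 'I_(2 * K).+1 * 'I_(2 * K).+1) u :=
  (jsq_step s.1.1.1 u, mm1_step s.1.1.2 u, mm2_step s.1.2 u, mm1_step s.2 u).

Lemma foldl_joint_step (K : nat)
    (s : ('I_K.+1 * 'I_K.+1) * 'I_K.+1 * 'I_(2 * K).+1 * 'I_(2 * K).+1) w :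
  foldl (@joint_step K) s w =
  (foldl (@jsq_step K) s.1.1.1 w, foldl (@mm1_step K) s.1.1.2 w,
   foldl (@mm2_step (2 * K)) s.1.2 w, foldl (@mm1_step (2 * K)) s.2 w).
Proof. by elim: w s => [[[[]]]|u w ih s]//=; rewrite ih. Qed.

Theorem proposition2 (R : realType) (rho : R) (K : nat) (rho_gt0 : 0 < rho)
    (init : ('I_K.+1 * 'I_K.+1) * 'I_K.+1 * 'I_(2 * K).+1 * 'I_(2 * K).+1 -> R)
    (init_ge0 : forall s, 0 <= init s)
    (init_sum1 : \sum_s init s = 1) :
  exists (d : measure_display) (Omega : measurableType d)
    (P : probability Omega R)
    (L : R -> Omega -> 'I_K.+1 * 'I_K.+1)
    (Nup : R -> Omega -> 'I_K.+1)
    (Nlow : R -> Omega -> 'I_(2 * K).+1)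
    (Nlowlow : R -> Omega -> 'I_(2 * K).+1),
  let N := fun t w => ((L t w).1 + (L t w).2)%N in
  let ordered := fun t w =>
    (Nlowlow t w <= Nlow t w)%N /\ (Nlow t w <= N t w)%N /\
    (N t w <= K + Nup t w)%N in
  [/\ is_ctmc P (@jsq_rate R rho K) L,
      is_ctmc P (@mmcm_rate R (2 * rho) 2 1 K) Nup,
      is_ctmc P (@mmcm_rate R (2 * rho) 1 2 (2 * K)) Nlow
    & is_ctmc P (@mmcm_rate R (2 * rho) 2 1 (2 * K)) Nlowlow] /\
  (forall s, P [set w | (L 0 w, Nup 0 w, Nlow 0 w, Nlowlow 0 w) = s]
             = (init s)%:E) /\
  (forall w, ordered 0 w -> forall t, 0 < t -> ordered t w).
Proof.
have rate_ge0 u : 0 <= mark_rate rho u.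
  by rewrite /mark_rate; case: ifP; rewrite ?ltW.
have rate_gt0 := total_mark_rate_gt0 rho_gt0.
have [d [T [P [z [W [W_prefix W_ctmc W_prob]]]]]] := driving_words_exist
  rate_ge0 rate_gt0 init_ge0 init_sum1.
exists d, T, P.
exists (fun t w => foldl (@jsq_step K) (z w).1.1.1 (W t w)).
exists (fun t w => foldl (@mm1_step K) (z w).1.1.2 (W t w)).
exists (fun t w => foldl (@mm2_step (2 * K)) (z w).1.2 (W t w)).
exists (fun t w => foldl (@mm1_step (2 * K)) (z w).2 (W t w)).
move=> N ordered; split; [split|split].
- apply: (W_ctmc _ _ (fun s => s.1.1.1)); exact: jsq_step_rate.
- apply: (W_ctmc _ _ (fun s => s.1.1.2)); exact: mm1_rate.
- apply: (W_ctmc _ _ (fun s => s.1.2)); exact: mm2_rate.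
- apply: (W_ctmc _ _ (fun s => s.2)); exact: mm1_rate.
- move=> s; under eq_set do rewrite -foldl_joint_step.
  (* The joint chain starts from [z] itself, and its transition function at time 0 is the
     identity. *)
  rewrite (W_prob _ _ id)//=; congr EFin.
  rewrite (bigD1 s)//= driven_trans0 ?eqxx ?mulr1 ?big1 ?addr0// => s' s's.
  by rewrite driven_trans0// (negbTE s's) mulr0.
- move=> w [ll_l [l_N N_up]] t t_gt0.
  (* [W 0 w] is not known to be empty on every path, so the induction starts from the states reached
     after it and reads the remaining word [v]. *)
  have /prefixP[v] := W_prefix w 0 t (lexx 0) (ltW t_gt0).
  rewrite /ordered /N => ->; rewrite !foldl_cat.
  by have [] := ordered_counts_foldl v (And3 ll_l l_N N_up).
Qed.
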